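(* Let $G$ be a group of polynomial growth, generated by a finite symmetric set, and let $\{B_n\}$ be the associated sequence of balls. Then there is a subsequence $F_i=B_{n(i)}$ along which the ratio ergodic theorem holds in density, i.e. for every ergodic measure-preserving action of $G$ on a $\sigma$-finite measure space $(X,\mathcal{B},\mu)$ and all $\varphi,\psi\in L^1(\mu)$ with $\int\psi\,d\mu\neq 0$, $$R_{F_i}(\varphi,\psi)\xrightarrow{\ \overline{d}\ }\frac{\int\varphi\,d\mu}{\int\psi\,d\mu}\qquad \mu\text{-a.e.}$$
   Context: The ball $B_n$ with respect to a finite symmetric generating set $A$ is the set of elements that are products of at most $n$ elements of $A$ (i.e. $(A\cup\{1_G\})^n$). $G$ has polynomial growth if $|B_n|\le c'n^{c}$ for all $n\ge 1$, for some constants $c,c'$. $G$ acts from the left by measure-preserving transformations $x\mapsto T^g x$. For finite $F\subseteq G$ put $S_F(\varphi)=\sum_{g\in F}\varphi\circ T^g$ and $R_F(\varphi,\psi)=S_F(\varphi)/S_F(\psi)$ (where the denominator is nonzero). The upper density of $I\subseteq\mathbb{N}$ is $\overline{d}(I)=\limsup_{N\to\infty}\frac1N|I\cap[1,N]|$. A sequence $a_n$ converges to $a$ in density, written $a_n\xrightarrow{\overline{d}}a$, if $\overline{d}(\{n : |a-a_n|>\varepsilon\})=0$ for every $\varepsilon>0$. *)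

(* Defs.v *)
From mathcomp Require Import all_boot all_order all_algebra finmap.
From mathcomp Require Import all_classical all_reals all_analysis.

Set Implicit Arguments.
Unset Strict Implicit.
Unset Printing Implicit Defensive.

Import Order.TTheory GRing.Theory Num.Theory.

Local Open Scope classical_set_scope.
Local Open Scope ring_scope.

Section Groups.
Context {G : groupType}.
Implicit Types A : {fset G}.

Definition symmetric_fset A : Prop := forall a, a \in A -> (a^-1)%g \in A.

Definition generates A : Prop :=
  forall S : {pred G}, group_closed S -> {subset A <= S} -> forall g, g \in S.

(* (A `|` {1})^n *)
Fixpoint word_ball A (n : nat) : {fset G} :=
  if n is m.+1 then
    [fset (a * b)%g | a in (1%g |` A)%fset, b in word_ball A m]%fset
  else [fset 1%g]%fset.

Definition polynomial_growth (R : realType) A : Prop :=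
  exists c c' : R, forall n : nat, (1 <= n)%N ->
    (#|` word_ball A n|)%:R <= c' * n%:R `^ c.

End Groups.

Section Actions.
Context {R : realType} {d : measure_display} {X : measurableType d}.
Context {G : groupType}.
Implicit Types (mu : {measure set X -> \bar R}) (T : G -> X -> X).

Record measure_preserving_action mu T : Prop := MeasurePreservingAction {
  mpa_one : forall x, T 1%g x = x ;
  mpa_mul : forall g h x, T (g * h)%g x = T g (T h x) ;
  mpa_measurable : forall g, measurable_fun [set: X] (T g) ;
  mpa_preserving : forall g (E : set X), measurable E ->
    mu (T g @^-1` E) = mu E }.

Definition ergodic_action mu T : Prop :=
  forall E : set X, measurable E -> (forall g, T g @^-1` E = E) ->
    mu E = 0%E \/ mu (~` E) = 0%E.

Definition ergodic_sum T (F : {fset G}) (phi : X -> R) (x : X) : R :=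
  \sum_(g <- F) phi (T g x).

(* Takes the junk value 0 where the denominator vanishes. *)
Definition ergodic_ratio T (F : {fset G}) (phi psi : X -> R) (x : X) : R :=
  ergodic_sum T F phi x / ergodic_sum T F psi x.

End Actions.

Section Density.
Context {R : realType}.

(* Index 0 is ignored: only [1, N] is counted. *)
Definition upper_density (I : set nat) : \bar R :=
  limn_esup (fun N : nat =>
    ((\sum_(1 <= k < N.+1) (k \in I : nat))%N%:R / N%:R : R)%:E).

Definition cvg_in_density (a : nat -> R) (l : R) : Prop :=
  forall eps : R, 0 < eps -> upper_density [set n | eps < `|l - a n|] = 0%E.

End Density.

(* Main.v *)
From Stdlib Require PeanoNat.
Require Import Defs.
From mathcomp Require Import all_boot all_order all_algebra finmap.
From mathcomp Require Import all_classical all_reals all_analysis.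
From mathcomp Require Import measurable_realfun.
From mathcomp Require Import ring lra zify.

Set Implicit Arguments.
Unset Strict Implicit.
Unset Printing Implicit Defensive.

Import Order.TTheory GRing.Theory Num.Theory.
Import numFieldNormedType.Exports.

Local Open Scope classical_set_scope.
Local Open Scope ring_scope.

(** Write S_r f for the sum of f over the ball of radius r along an orbit.
Let p be a positive integrable function with |phi|, |psi| <= p.  The ratio of
phi to psi is the quotient of their ratios to p, so it suffices to prove that
S_(n(i)) f / S_(n(i)) p tends to c = int f / int p in density for |f| <= p
([ratio_cvgd]), and one may take f >= 0 since adding p to f adds 1 to the ratio.

Balls of a group of polynomial growth need not satisfy a Besicovitch covering
property, so a maximal inequality over all radii may fail.  One does hold
along a large set of indices, because the weight V(r) = S_r p (x) is a
nondecreasing function of r which grows slowly for almost every x.  Since int S_r p is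
|B_r| int p, the polynomial growth and a Borel-Cantelli argument bound
ln V(n(i)) by O(sqrt i) for the radii n(i) = i + 4^(floor (sqrt i))
([slow_radius], [orbit_growth]).  Increments of ln V(n(i)) telescope, which
gives two facts.
- For a fixed lag k, the sum over i <= N of ln V(n(i+k)) - ln V(n(i)) is
  O(sqrt N), hence the shells between the radii n(i) - k and n(i) + k have
  small relative weight for i outside a set of density zero
  ([shell_density_zero]).
- As 2 n(i) <= n(i + 4 sqrt i + 4), the sum over i <= N of
  ln V(2 n(i)) - ln V(n(i)) involves a lag O(sqrt N) and is thus O(N); hence,
  for every e, V(2 n(i)) <= D V(n(i)) for i outside a set of upper density at
  most e, with D depending on e and the growth of the group, not on x
  ([doubling_density_le]).
The radii are a compromise: for n(i) = 2^i the shells need not be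
negligible, and for n(i) polynomial in i the doubling would be controlled only
in logarithmic density.

At radii where V doubles by a factor at most D, the Vitali argument
([vitali_ball_sum]) and transference to the group yield a weak type (1,1)
inequality with constant 2 D ([maximal_ineq]).

It remains to approximate f - c p by functions whose ratios tend to 0.  In an
ergodic action two nonnegative functions with equal integrals can be
transported onto each other: going through the elements g of the group, move
from f as much mass u as fits below what is still missing in c p.  What is
never moved lives on two sets no translate of which meet, so by ergodicity it
vanishes ([integral_residual_cvg0]).  Stopping this process at a finite stage
writes f - c p as a finite sum of coboundaries u - u o T^g with 0 <= u <= f,
whose ergodic sums live on shells ([coboundary_le_shell]), plus an error of
small integral, which the maximal inequality controls ([heavy_null]). *)

(** * Word balls *)
Section Balls.
Context {G : groupType} (A : {fset G}).
Local Notation B := (word_ball A).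

Lemma mem_ball0 g : (g \in B 0) = (g == 1%g).
Proof. by rewrite /= in_fset1. Qed.

Lemma mem_ballSP g n : reflect
  (exists a b, [/\ a \in (1%g |` A)%fset, b \in B n & g = (a * b)%g]) (g \in B n.+1).
Proof.
apply: (iffP idP) => [/imfset2P[a aA [b bB ->]]|[a [b [aA bB ->]]]].
  by exists a, b.
by apply/imfset2P; exists a => //; exists b.
Qed.

Lemma one_mem_ball n : 1%g \in B n.
Proof.
elim: n => [|n IHn]; first by rewrite mem_ball0.
by apply/mem_ballSP; exists 1%g, 1%g; rewrite fset1U1 mulg1.
Qed.

Lemma mulg_mem_ball m n g h : g \in B m -> h \in B n -> (g * h)%g \in B (m + n).
Proof.
elim: m g => [|m IHm] g; first by rewrite mem_ball0 => /eqP -> hB; rewrite mul1g.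
move=> /mem_ballSP[a [b [aA bB ->]]] hB; rewrite addSn; apply/mem_ballSP.
by exists a, (b * h)%g; rewrite -mulgA; split=> //; exact: IHm.
Qed.

Lemma ball_subset m n : (m <= n)%N -> {subset B m <= B n}.
Proof.
move=> mn g gB; rewrite -(subnK mn) -[g]mul1g.
by apply: mulg_mem_ball => //; exact: one_mem_ball.
Qed.

Lemma mem_ball1 a : a \in A -> a \in B 1.
Proof.
move=> aA; apply/mem_ballSP; exists a, 1%g.
by rewrite mulg1 mem_ball0 eqxx in_fset1U aA orbT.
Qed.

Lemma invg_mem_ball n g : symmetric_fset A -> g \in B n -> (g^-1)%g \in B n.
Proof.
move=> symA; elim: n g => [|n IHn] g.
  by rewrite !mem_ball0 => /eqP ->; rewrite invg1.
move=> /mem_ballSP[a [b [aA bB ->]]]; rewrite invgM -addn1.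
apply: mulg_mem_ball; first exact: IHn.
move: aA; rewrite in_fset1U => /orP[/eqP ->|aA]; first by rewrite invg1 one_mem_ball.
exact/mem_ball1/symA.
Qed.

Lemma mem_some_ball : symmetric_fset A -> generates A -> forall g, exists n, g \in B n.
Proof.
move=> symA genA g.
have : g \in [pred h : G | `[< exists n, h \in B n >]].
  apply: genA => [|a aA]; last by apply/asboolP; exists 1; exact: mem_ball1.
  split=> [|x y /asboolP[m xm] /asboolP[n yn]].
    by apply/asboolP; exists 0; exact: one_mem_ball.
  apply/asboolP; exists (m + n)%N; apply: mulg_mem_ball => //.
  exact: invg_mem_ball.
by move/asboolP.
Qed.

End Balls.

(** * A Vitali argument on the group *)
Section Covering.
Context {R : realType} {G : groupType} (A : {fset G}).
Local Notation B := (word_ball A).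

Definition ball_at (n : nat) (h : G) : {fset G} := [fset (g * h)%g | g in B n]%fset.

Lemma mem_ball_at n h k : (k \in ball_at n h) = ((k * h^-1)%g \in B n).
Proof.
apply/imfsetP/idP => [[g /= gB ->]|kB]; first by rewrite mulgK.
by exists (k * h^-1)%g => //; rewrite mulgVK.
Qed.

Lemma sum_ball_at n h (w : G -> R) :
  \sum_(k <- ball_at n h) w k = \sum_(g <- B n) w (g * h)%g.
Proof. by rewrite big_imfset //= => x y _ _; exact: mulIg. Qed.

Lemma ball_at_center n h : h \in ball_at n h.
Proof. by rewrite mem_ball_at mulgV one_mem_ball. Qed.

(** The Vitali step: translates are on the right, so z = b h = b' k gives
h k^-1 = b^-1 b', and only the centre h has to be recaptured by the larger
ball.  This is why the double radius suffices. *)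
Lemma ball_at_meet m n h k z : symmetric_fset A -> (m <= n)%N ->
  z \in ball_at m h -> z \in ball_at n k -> h \in ball_at (2 * n) k.
Proof.
move=> symA mn; rewrite !mem_ball_at => zh zk.
have -> : (h * k^-1 = (z * h^-1)^-1 * (z * k^-1))%g.
  by rewrite invgM invgK -mulgA mulKg.
apply: (@ball_subset _ _ (m + n)); first by rewrite mul2n -addnn leq_add2r.
by apply: mulg_mem_ball => //; exact: invg_mem_ball.
Qed.

Lemma sum_fsetD (w : G -> R) (J K : {fset G}) : {subset J <= K} ->
  \sum_(g <- K) w g = \sum_(g <- J) w g + \sum_(g <- (K `\` J)%fset) w g.
Proof.
move=> /fsubsetP JK; rewrite (big_fsetID _ (mem J) K) /=.
have -> : [fset x in K | x \in J]%fset = J.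
  by apply/fsetP => x; rewrite !inE; apply/andb_idl => /(fsubsetP JK).
have -> // : [fset x in K | x \notin J]%fset = (K `\` J)%fset.
by apply/fsetP => x; rewrite !inE andbC.
Qed.

Lemma sum_fset_subset (w : G -> R) (J K : {fset G}) : (forall g, 0 <= w g) ->
  {subset J <= K} -> \sum_(g <- J) w g <= \sum_(g <- K) w g.
Proof. by move=> w0 JK; rewrite (sum_fsetD w JK) lerDl sumr_ge0. Qed.

(** Greedy covering: a ball of maximal radius is kept, all centres in its double
are discarded, and the balls around the remaining centres avoid it by
[ball_at_meet].  The kept balls are disjoint and their doubles carry all
centres; each double weighs at most D times its ball, which weighs at most
f of the ball divided by lam. *)
Lemma vitali_ball_sum (w f : G -> R) (r : G -> nat) (lam D : R) (J U : {fset G}) :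
    symmetric_fset A -> (forall g, 0 <= w g) -> (forall g, 0 <= f g) ->
    0 <= lam -> 0 <= D ->
    (forall h, h \in J ->
       \sum_(k <- ball_at (2 * r h) h) w k <= D * \sum_(k <- ball_at (r h) h) w k) ->
    (forall h, h \in J ->
       lam * \sum_(k <- ball_at (r h) h) w k <= \sum_(k <- ball_at (r h) h) f k) ->
    (forall h, h \in J -> {subset ball_at (r h) h <= U}) ->
  lam * \sum_(h <- J) w h <= D * \sum_(k <- U) f k.
Proof.
move=> symA w0 f0 lam0 D0.
have [n] := ubnP #|` J|; elim: n J U => // n IHn J U; rewrite ltnS => Jn dblJ densJ subJ.
have [->|[h0 h0J]] := fset_0Vmem J.
  by rewrite big_seq_fset0 mulr0 mulr_ge0// sumr_ge0.
have [h hJ hmax] : exists2 h, h \in J & forall k, k \in J -> (r k <= r h)%N.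
  have [h _ hmax] := @arg_maxnP _ [` h0J]%fset xpredT (fun x => r (val x)) isT.
  by exists (val h) => [|k kJ]; [exact: valP|exact: (hmax [` kJ]%fset)].
pose J' := (J `\` ball_at (2 * r h) h)%fset.
pose U' := (U `\` ball_at (r h) h)%fset.
have J'J : {subset J' <= J} by move=> k; rewrite inE => /andP[].
(* The induction hypothesis applies to U' because no remaining ball meets the
   chosen one. *)
have IH : lam * \sum_(h <- J') w h <= D * \sum_(k <- U') f k.
  apply: IHn => [|k /J'J kJ|k /J'J kJ|k]; [|exact: dblJ|exact: densJ|].
    apply: leq_trans Jn; apply: fproper_ltn_card; rewrite fproperE.
    apply/andP; split; first exact/fsubsetP.
    apply/fsubsetPn; exists h => //.
    by rewrite inE ball_at_center.
  rewrite inE => /andP[kh kJ] z zk; rewrite inE (subJ k kJ z zk) andbT.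
  by apply: contra kh => zh; apply: (ball_at_meet symA (hmax k kJ)) zk zh.
rewrite (sum_fsetD f (subJ _ hJ)) -/U' mulrDr.
apply: (@le_trans _ _ (lam * (\sum_(k <- ball_at (2 * r h) h) w k + \sum_(k <- J') w k))).
  apply: ler_wpM2l => //.
  rewrite (big_fsetID _ (mem (ball_at (2 * r h) h)) J) /=; apply: lerD.
    by apply: sum_fset_subset => // k; rewrite !inE => /andP[].
  by apply: sum_fset_subset => // k; rewrite !inE andbC.
rewrite mulrDr lerD//; apply: le_trans (ler_wpM2l D0 (densJ h hJ)).
by rewrite mulrCA ler_wpM2l// dblJ.
Qed.

End Covering.

(** * Growth of balls *)
Section Growth.
Context {G : groupType} (A : {fset G}).
Local Notation B := (word_ball A).

Lemma polynomial_growth_nat (R : realType) : polynomial_growth R A ->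
  exists K k : nat, forall n, (0 < n)%N -> (#|` B n| <= K * n ^ k)%N.
Proof.
move=> [c [c' cc']]; pose k := (Num.truncn `|c|).+1; pose K := (Num.truncn `|c'|).+1.
exists K, k => n n0; rewrite -(ler_nat R) natrM natrX.
apply: le_trans (cc' n n0) _; apply: (@le_trans _ _ (`|c'| * n%:R `^ c)).
  by rewrite ler_wpM2r ?powR_ge0 ?ler_norm.
apply: ler_pM; rewrite ?powR_ge0//.
  by apply/ltW; exact: truncnS_gt.
rewrite -powR_mulrn// ler_powR ?ler1n//.
by apply: le_trans (ler_norm _) _; apply/ltW; exact: truncnS_gt.
Qed.

Lemma exp_beats_poly a k : exists m, (a + m * k < 2 ^ m)%N.
Proof.
(* With x = a + k, the bound x < 2 ^ x gives (x + 1) ^ 4 <= 2 ^ (4 * x). *)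
exists (4 * (a + k))%N; set x := (a + k)%N.
have x2 : (x < 2 ^ x)%N by exact: ltn_expl.
have : (x.+1 ^ 4 <= 2 ^ (4 * x))%N by rewrite mulnC expnM leq_exp2r.
have : (x + 4 * x * x < x.+1 ^ 4)%N by rewrite !expnS expn0; nia.
rewrite /x; nia.
Qed.

(** Were the cardinality to double at every step of length r, it would grow
exponentially.  The factor 2, instead of one close to 1, only costs a constant
in the maximal inequality. *)
Lemma folner_ball (R : realType) : polynomial_growth R A ->
  forall r, exists n, (#|` B (n + r)| <= 2 * #|` B n|)%N.
Proof.
move=> /polynomial_growth_nat[K [k growth]] [|r].
  by exists 0; rewrite addn0 mul2n -addnn leq_addr.
apply: contrapT => /forallNP dbl.
have {}dbl n : (2 * #|` B n| <= #|` B (n + r.+1)|)%N.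
  by rewrite leqNgt; apply/negP => /ltnW/dbl.
have expo j : (2 ^ j <= #|` B (j * r.+1)|)%N.
  elim: j => [|j IHj]; first by rewrite mul0n /= cardfs1.
  by rewrite expnS (mulSnr j) (leq_trans _ (dbl _))// leq_mul2l IHj.
pose a := (K * r.+1 ^ k)%N.
have [m /ltnW mP] := exp_beats_poly a.+1 k.
have := leq_trans (expo (2 ^ m)%N) (growth (2 ^ m * r.+1)%N _).
rewrite muln_gt0 expn_gt0 => /(_ isT); rewrite expnMn mulnCA -/a -expnM.
apply/negP; rewrite -ltnNge mulnC.
apply: (@leq_trans (2 ^ (a + m * k))).
  by rewrite expnD ltn_pmul2r ?expn_gt0// ltn_expl.
by rewrite leq_exp2l// (leq_trans _ mP)// leq_add2r.
Qed.

End Growth.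

(** * Density of sets of indices *)
Section Density.
Context {R : realType}.
Implicit Types (I J : set nat) (e : R).

Definition count_upto I (N : nat) : nat := (\sum_(1 <= k < N.+1) (k \in I : nat))%N.

(** This implies upper density at most e.  The additive constant takes the place
of a limit superior and makes finite changes and shifts of I harmless. *)
Definition density_le I e : Prop :=
  exists C : R, forall N, (count_upto I N)%:R <= e * N%:R + C.

Definition density_zero I : Prop := forall e, 0 < e -> density_le I e.

Lemma count_uptoS I N : count_upto I N.+1 = (count_upto I N + (N.+1 \in I))%N.
Proof. by rewrite /count_upto big_nat_recr. Qed.

Lemma count_upto0 I : count_upto I 0 = 0%N.
Proof. by rewrite /count_upto big_geq. Qed.

Lemma count_upto_le I N : (count_upto I N <= N)%N.
Proof.
elim: N => [|N IHN]; first by rewrite count_upto0.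
by rewrite count_uptoS; case: (_ \in I) => /=; lia.
Qed.

Lemma count_upto_shift I J m : (forall i, (m < i)%N -> I i -> J (i - m)%N) ->
  forall N, (count_upto I N <= m + count_upto J (N - m))%N.
Proof.
move=> IJ; elim=> [|N IHN]; first by rewrite count_upto0.
have [Nm|mN] := leqP N.+1 m.
  by apply: (leq_trans (count_upto_le _ _)); lia.
rewrite subSn// !count_uptoS addnA leq_add// -subSn//.
case: (boolP (_ \in I)) => //; rewrite inE => /(IJ _ mN) JN.
by rewrite (mem_set JN).
Qed.

Lemma density_le_shift I J m e : 0 <= e ->
  (forall i, (m < i)%N -> I i -> J (i - m)%N) -> density_le J e -> density_le I e.
Proof.
move=> e0 IJ [C JC]; exists (C + m%:R) => N.
have := count_upto_shift IJ N; rewrite -(ler_nat R) natrD => /le_trans; apply.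
have := JC (N - m)%N; have : (N - m)%:R <= N%:R :> R by rewrite ler_nat leq_subr.
by move=> /(ler_wpM2l e0); lra.
Qed.

Lemma sub_density_le I J e : I `<=` J -> density_le J e -> density_le I e.
Proof.
move=> IJ [C JC]; exists C => N; apply: le_trans (JC N); rewrite ler_nat.
apply: leq_sum => i _; case: (boolP (_ \in I)) => //.
by rewrite inE => /IJ Ji; rewrite (mem_set Ji).
Qed.

Lemma density_le_setU I J e e' : density_le I e -> density_le J e' ->
  density_le (I `|` J) (e + e').
Proof.
move=> [C IC] [C' JC]; exists (C + C') => N; rewrite mulrDl addrACA.
apply: le_trans (lerD (IC N) (JC N)); rewrite -natrD ler_nat /count_upto -big_split.
by apply: leq_sum => i _; rewrite in_setU; do 2 case: (_ \in _).
Qed.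

Lemma le_density_le I e e' : e <= e' -> density_le I e -> density_le I e'.
Proof.
move=> ee' [C IC]; exists C => N; apply: le_trans (IC N) _.
by rewrite lerD2r ler_wpM2r.
Qed.

Lemma sub_density_zero I J : I `<=` J -> density_zero J -> density_zero I.
Proof. by move=> IJ J0 e /J0; exact: sub_density_le. Qed.

Lemma density_zero_shift I J m : (forall i, (m < i)%N -> I i -> J (i - m)%N) ->
  density_zero J -> density_zero I.
Proof.
by move=> IJ J0 e e0; apply: (density_le_shift (ltW e0) IJ); exact: J0.
Qed.

Lemma density_zeroU I J : density_zero I -> density_zero J -> density_zero (I `|` J).
Proof.
move=> I0 J0 e e0; rewrite (splitr e).
by apply: density_le_setU; [apply: I0|apply: J0]; rewrite divr_gt0.
Qed.

Lemma density_zero_set0 : density_zero set0.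
Proof.
move=> e e0; exists 0 => N; rewrite /count_upto big1 ?addr0 ?mulr_ge0 ?(ltW e0)//.
by move=> i _; rewrite in_set0.
Qed.

Lemma density_zero_eventually I J m : (forall i, (m < i)%N -> I i -> J i) ->
  density_zero J -> density_zero I.
Proof.
move=> IJ J0; have le0 : density_zero [set i | (i <= m)%N].
  apply: (@density_zero_shift _ set0 m) density_zero_set0 => i mi /=.
  by rewrite leqNgt mi.
apply: sub_density_zero (density_zeroU le0 J0) => i Ii.
by have [im|mi] := leqP i m; [left|right; exact: IJ].
Qed.

Lemma upper_density_eq0 I : density_zero I -> upper_density (R := R) I = 0%E.
Proof.
move=> I0; apply: (cvg_limn_einf_sup _).2.
apply: cvg_EFin; first exact: nearW.
apply/cvgrPdist_le => e e0; have [C IC] := I0 (e / 2) ltac:(by rewrite divr_gt0).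
near=> N.
have N0 : 0 < N%:R :> R by rewrite ltr0n; near: N; exact: nbhs_infty_gt.
rewrite sub0r normrN ger0_norm ?divr_ge0// ler_pdivrMr//.
apply: le_trans (IC N) _.
suff : C <= e / 2 * N%:R by lra.
rewrite -ler_pdivrMl ?divr_gt0//; near: N; exact: nbhs_infty_ger.
Unshelve. all: by end_near. Qed.

(** Convergence in density, expressed with [density_zero] so that exceptional
sets can be united and compared. *)
Definition cvgd (a : nat -> R) (l : R) : Prop :=
  forall eps, 0 < eps -> density_zero [set i | eps < `|a i - l|].

Lemma eq_cvgd a b l : a =1 b -> cvgd a l -> cvgd b l.
Proof. by move=> /funext ->. Qed.

Lemma cvgd_cst l : cvgd (fun=> l) l.
Proof.
move=> eps eps0; apply: sub_density_zero density_zero_set0 => i /=.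
by rewrite subrr normr0 ltNge (ltW eps0).
Qed.

Lemma cvgdD a b l m : cvgd a l -> cvgd b m -> cvgd (fun i => a i + b i) (l + m).
Proof.
move=> al bm eps eps0.
have e2 : 0 < eps / 2 by rewrite divr_gt0.
apply: sub_density_zero (density_zeroU (al _ e2) (bm _ e2)) => i /= h.
apply: contrapT => /not_orP[/negP]; rewrite -leNgt => ai /negP; rewrite -leNgt => bi.
have := ler_normD (a i - l) (b i - m); rewrite addrACA -opprD; lra.
Qed.

Lemma cvgd_sum0 (a : nat -> nat -> R) (J : nat) :
  (forall j, cvgd (a j) 0) -> cvgd (fun i => \sum_(j < J) a j i) 0.
Proof.
move=> a0; elim: J => [|J IHJ].
  by apply: eq_cvgd (cvgd_cst 0) => i; rewrite big_ord0.
rewrite -[X in cvgd _ X]addr0.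
apply: eq_cvgd (cvgdD IHJ (a0 J)) => i; by rewrite big_ord_recr.
Qed.

Lemma cvgd_neq0 b m : cvgd b m -> m != 0 -> density_zero [set i | b i = 0].
Proof.
move=> bm m0; have m2 : 0 < `|m| / 2 by rewrite divr_gt0 ?normr_gt0.
apply: sub_density_zero (bm _ m2) => i /= ->; rewrite sub0r normrN.
by rewrite gtr_pMr ?normr_gt0// invf_lt1 ?ltr1n.
Qed.

Lemma cvgd_div a b l m : cvgd a l -> cvgd b m -> m != 0 ->
  cvgd (fun i => a i / b i) (l / m).
Proof.
(* The thresholds d0 and d1 come from
   a / b - l / m = ((a - l) m - l (b - m)) / (b m) and |m| / 2 <= |b|. *)
move=> al bm m0 eps eps0; have m_gt0 : 0 < `|m| by rewrite normr_gt0.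
have m2 : 0 < `|m| / 2 by rewrite divr_gt0.
have d0 : 0 < eps * `|m| / 4 by rewrite divr_gt0 ?mulr_gt0.
have d1 : 0 < eps * (`|m| * `|m|) / (4 * (1 + `|l|)).
  by rewrite divr_gt0 ?mulr_gt0 ?ltr_pwDl.
apply: sub_density_zero (density_zeroU (density_zeroU (al _ d0) (bm _ d1)) (bm _ m2)).
move=> i /= h; apply: contrapT => /not_orP[/not_orP[/negP]].
rewrite -leNgt => ai /negP; rewrite -leNgt => bi1 /negP; rewrite -leNgt => bi2.
have bm2 : `|m| / 2 <= `|b i|.
  by have := ler_normD (m - b i) (b i); rewrite subrK distrC; lra.
have b_gt0 : 0 < `|b i| by lra.
move: h; apply/negP; rewrite -leNgt.
have -> : a i / b i - l / m = ((a i - l) * m - l * (b i - m)) / (b i * m).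
  by field; rewrite m0 -normr_gt0.
rewrite normrM normfV ler_pdivrMr ?normrM ?mulr_gt0//.
apply: le_trans (ler_normB _ _) _; rewrite !normrM.
have h1 : `|a i - l| * `|m| <= eps * `|m| / 4 * `|m| by rewrite ler_wpM2r.
have h2 : `|l| * `|b i - m| <= eps * (`|m| * `|m|) / 4.
  have l0 : 0 < 4 * (1 + `|l|) by rewrite mulr_gt0// ltr_pwDl.
  move: bi1; rewrite ler_pdivlMr// => bi1.
  have := normr_ge0 (b i - m); nra.
have h3 : eps * (`|m| / 2) * `|m| <= eps * `|b i| * `|m|.
  by rewrite ler_pM2r// ler_pM2l.
have -> : eps * (`|b i| * `|m|) = eps * `|b i| * `|m| by rewrite mulrA.
lra.
Qed.

End Density.

(** * Jumps of slowly growing sequences *)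
Section SlowJumps.
Context {R : realType}.
Local Notation rt := PeanoNat.Nat.sqrt.

Lemma sqrtn_le i : (rt i * rt i <= i)%N.
Proof. by have [] := PeanoNat.Nat.sqrt_spec i (PeanoNat.Nat.le_0_l i); lia. Qed.

Lemma sqrtn_gt i : (i < (rt i).+1 * (rt i).+1)%N.
Proof. by have [] := PeanoNat.Nat.sqrt_spec i (PeanoNat.Nat.le_0_l i); lia. Qed.

Lemma leq_sqrtn i j : (i <= j)%N -> (rt i <= rt j)%N.
Proof. by have := sqrtn_le i; have := sqrtn_gt j; nia. Qed.

Lemma sqrtn_sqr s : rt (s * s)%N = s.
Proof. by have := sqrtn_le (s * s); have := sqrtn_gt (s * s); nia. Qed.

Variable a : nat -> R.
Hypothesis a_mono : forall i j, (i <= j)%N -> a i <= a j.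

(** A sum of lag-k increments is k telescoping sums of lag-one increments. *)
Lemma sum_lag_le (k N : nat) :
  \sum_(0 <= j < N) (a (j + k)%N - a j) <= k%:R * (a (N + k)%N - a 0).
Proof.
elim: k => [|k IHk].
  by rewrite big1 ?mul0r// => i _; rewrite addn0 subrr.
rewrite (eq_bigr (fun j => (a (j + k)%N - a j) + (a (j.+1 + k)%N - a (j + k)%N))); last first.
  by move=> j _; rewrite addSnnS; ring.
rewrite big_split /= (telescope_sumr (fun j => a (j + k)%N))// add0n.
rewrite -natr1 mulrDl mul1r lerD//; last first.
  by rewrite lerB ?a_mono// leq_add2l.
by apply: le_trans IHk _; rewrite ler_wpM2l// lerB ?a_mono// leq_add2l.
Qed.

Lemma count_jumps_le (kappa : nat -> nat) (eta : R) (k N : nat) : 0 < eta ->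
  (forall i, (i <= N)%N -> (kappa i <= k)%N) ->
  eta * (count_upto [set i | eta < a (i + kappa i)%N - a i] N)%:R <=
  k%:R * (a (N.+1 + k)%N - a 0).
Proof.
move=> eta0 kk; apply: le_trans (sum_lag_le k N.+1).
rewrite /count_upto natr_sum mulr_sumr [leRHS]big_ltn//.
rewrite -[leLHS]add0r lerD ?subr_ge0 ?a_mono//.
apply: ler_sum_nat => i /andP[_ iN].
have : a (i + kappa i)%N <= a (i + k)%N by rewrite a_mono// leq_add2l kk.
case: (boolP (_ \in _)) => [|_] /=; first by rewrite inE /= mulr1; lra.
by move=> _; rewrite mulr0 subr_ge0; apply: a_mono; exact: leq_addr.
Qed.

Variables C q : R.
Hypotheses (q0 : 0 < q) (a_sqrt : forall i, a i <= C + q * (rt i)%:R).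

(** The increments up to N add up to O(sqrt N), so at most O(sqrt N) of them
exceed eta. *)
Lemma jumps_density_zero (k : nat) (eta : R) : 0 < eta ->
  density_zero (R := R) [set i | eta < a (i + k)%N - a i].
Proof.
move=> eta0 e e0; pose c := k%:R * q / eta.
have c0 : 0 <= c by rewrite divr_ge0 ?mulr_ge0// ltW.
pose del := e / (c + 1); have del0 : 0 < del by rewrite divr_gt0// ltr_wpDl.
have cdel : c * del <= e.
  by rewrite /del mulrCA ler_piMr ?(ltW e0)// ler_pdivrMr ?mul1r ?lerDl// ltr_wpDl.
exists (k%:R / eta * (C - a 0) + c * (del * (k.+1)%:R + del^-1)) => N.
have := @count_jumps_le (fun=> k) eta k N eta0 (fun i _ => leqnn k).
rewrite -ler_pdivlMl// => /le_trans; apply.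
(* s <= del * s ^ 2 + 1 / del holds for every s: distinguish s <= 1 / del. *)
have sq : (rt (N.+1 + k))%:R <= del * (N.+1 + k)%:R + del^-1.
  have := sqrtn_le (N.+1 + k); rewrite -(ler_nat R) natrM.
  set s : R := (rt _)%:R => sN.
  have s0 : 0 <= s by [].
  have : del * (s * s) <= del * (N.+1 + k)%:R by rewrite ler_pM2l.
  have [sd|sd] := leP (s * del) 1.
    move=> _; apply: (@le_trans _ _ del^-1).
      by rewrite -[leRHS]mul1r ler_pdivlMr.
    by rewrite lerDr mulr_ge0 ?(ltW del0).
  move=> /le_trans h; apply: (@le_trans _ _ (del * (s * s))).
    by rewrite mulrA ler_peMl// mulrC ltW.
  apply: h; by rewrite lerDl invr_ge0 ltW.
have : eta^-1 * (k%:R * (a (N.+1 + k)%N - a 0)) <=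
   k%:R / eta * (C - a 0) + c * (rt (N.+1 + k))%:R.
  apply: (@le_trans _ _ (eta^-1 * (k%:R * (C + q * (rt (N.+1 + k))%:R - a 0)))).
    by rewrite ler_pM2l ?invr_gt0// ler_wpM2l// lerD2r.
  by rewrite le_eqVlt; apply/orP; left; apply/eqP; rewrite /c; field; rewrite gt_eqF.
move=> /le_trans; apply; rewrite [leRHS]addrCA lerD2l.
apply: le_trans (ler_wpM2l c0 sq) _.
have := ler_wpM2r (ler0n R N) cdel.
by rewrite addSnnS natrD; lra.
Qed.

(** Now both the lag 4 sqrt i + 4 and the total growth up to N are O(sqrt N), so
the increments add up to O(N); the leading constant is 4 q, and 5 q absorbs the
terms of lower order. *)
Lemma big_jumps_density_le (eta : R) : 0 < eta ->
  density_le [set i | eta < a (i + (4 * rt i + 4))%N - a i] (5 * q / eta).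
Proof.
move=> eta0; pose C1 := `|C - a 0|; pose c := 4 * C1 + 12 * q.
exists (eta^-1 * (c ^+ 2 / q + 4 * C1 + 8 * q)) => N.
pose S := rt N.
have kS i : (i <= N)%N -> (4 * rt i + 4 <= 4 * S + 4)%N.
  by move=> /leq_sqrtn; rewrite /S; lia.
have := count_jumps_le eta0 kS.
rewrite -ler_pdivlMl// => /le_trans; apply.
rewrite [X in _ <= X + _](_ : _ = eta^-1 * (5 * q * N%:R)); last by ring.
rewrite -mulrDr.
rewrite ler_pM2l ?invr_gt0//.
have rtN : (rt (N.+1 + (4 * S + 4)) <= S + 2)%N.
  have := sqrtn_le (N.+1 + (4 * S + 4)); have := sqrtn_gt N; rewrite -/S; nia.
have aN : a (N.+1 + (4 * S + 4))%N - a 0 <= C1 + q * (S%:R + 2).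
  have := a_sqrt (N.+1 + (4 * S + 4)).
  have : q * (rt (N.+1 + (4 * S + 4)))%:R <= q * (S%:R + 2).
    by rewrite ler_pM2l// -natrD ler_nat.
  by have := ler_norm (C - a 0); rewrite -/C1; lra.
apply: le_trans (ler_wpM2l (ler0n _ _) aN) _; rewrite natrD natrM.
have SN : S%:R * S%:R <= N%:R :> R by rewrite -natrM ler_nat sqrtn_le.
have sc : S%:R * c <= q * (S%:R * S%:R) + c ^+ 2 / q.
  have cq : q * (c ^+ 2 / q) = c ^+ 2 by rewrite mulrC divfK ?gt_eqF.
  rewrite -(ler_pM2l q0); move: cq; clearbody c; move: (_ / _) => t.
  have := sqr_ge0 (q * S%:R - c / 2); have := sqr_ge0 c; rewrite !expr2; lra.
have := ler_wpM2l (ltW q0) SN; move: sc; rewrite /c; lra.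
Qed.

End SlowJumps.

(** * Ergodic sums and the maximal inequality *)

Lemma measurable_ler_set {R : realType} {d} {X : measurableType d} (f g : X -> R) :
  measurable_fun [set: X] f -> measurable_fun [set: X] g ->
  measurable [set x | f x <= g x].
Proof.
move=> mf mg; rewrite -[X in measurable X]setTI.
have := measurable_fun_ler mf mg measurableT (I : measurable [set true]).
by rewrite preimage_true.
Qed.

Section Actions.
Context {R : realType} {d : measure_display} {X : measurableType d} {G : groupType}.
Variables (mu : {measure set X -> \bar R}) (T : G -> X -> X).
Hypothesis mpa : measure_preserving_action mu T.

Lemma integral_translate (g : G) (f : X -> \bar R) :
  measurable_fun [set: X] f -> (forall x, (0 <= f x)%E) ->
  (\int[mu]_x f (T g x) = \int[mu]_x f x)%E.
Proof.
move=> mf f0; have mT := mpa_measurable mpa g.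
have := ge0_integral_pushforward mT mu measurableT mf.
rewrite preimage_setT => <-; last by move=> y _; exact: f0.
by apply: eq_measure_integral => E mE _; exact: (mpa_preserving mpa).
Qed.

Lemma measurable_translate (g : G) (f : X -> R) :
  measurable_fun [set: X] f -> measurable_fun [set: X] (f \o T g).
Proof. by move=> mf; exact: measurableT_comp mf (mpa_measurable mpa g). Qed.

Lemma measurable_ergodic_sum (F : {fset G}) (f : X -> R) :
  measurable_fun [set: X] f -> measurable_fun [set: X] (ergodic_sum T F f).
Proof. by move=> mf; apply: measurable_sum => g; exact: measurable_translate. Qed.

Lemma ergodic_sum_ge0 (F : {fset G}) (f : X -> R) x : (forall y, 0 <= f y) ->
  0 <= ergodic_sum T F f x.
Proof. by move=> f0; exact: sumr_ge0. Qed.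

Lemma integral_ergodic_sum (F : {fset G}) (f : X -> R) :
  measurable_fun [set: X] f -> (forall x, 0 <= f x) ->
  (\int[mu]_x (ergodic_sum T F f x)%:E = (#|` F|)%:R%:E * \int[mu]_x (f x)%:E)%E.
Proof.
move=> mf f0.
under eq_integral do rewrite /ergodic_sum -sumEFin.
rewrite ge0_integral_sum//; last 2 first.
- by move=> g; apply/measurable_EFinP; exact: measurable_translate.
- by move=> g x _; rewrite lee_fin.
rewrite (eq_bigr (fun=> \int[mu]_x (f x)%:E)%E) => [|g _]; last first.
  rewrite -(integral_translate g (f := EFin \o f))//.
  exact/measurable_EFinP.
by rewrite big_const_seq count_predT iter_addr addr0 mule_natl.
Qed.


Section MaximalInequality.
Variables (A : {fset G}).
Local Notation B := (word_ball A).
Local Notation S n f x := (ergodic_sum T (B n) f x).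

(** At the radius r, f is heavy with respect to p and p doubles by a factor at
most D.  Restricting to doubling radii is what makes the Vitali argument work. *)
Definition heavy_at (lam D : R) (p f : X -> R) (r : nat) : set X :=
  [set x | lam * S r p x <= S r f x /\ S (2 * r) p x <= D * S r p x].

Definition heavy_upto (lam D : R) (p f : X -> R) (N : nat) : set X :=
  \bigcup_(r < N.+1) heavy_at lam D p f r.

Definition heavy (lam D : R) (p f : X -> R) : set X :=
  \bigcup_r heavy_at lam D p f r.

Lemma measurable_heavy_at lam D p f r : measurable_fun [set: X] p ->
  measurable_fun [set: X] f -> measurable (heavy_at lam D p f r).
Proof.
move=> mp mf; have mS n u := @measurable_ergodic_sum (B n) u.
by apply: measurableI; apply: measurable_ler_set => //;
  try (apply: measurable_funM => //); exact: mS.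
Qed.

Lemma measurable_heavy_upto lam D p f N : measurable_fun [set: X] p ->
  measurable_fun [set: X] f -> measurable (heavy_upto lam D p f N).
Proof.
by move=> mp mf; apply: bigcup_measurable => r _; exact: measurable_heavy_at.
Qed.

Lemma measurable_heavy lam D p f : measurable_fun [set: X] p ->
  measurable_fun [set: X] f -> measurable (heavy lam D p f).
Proof.
by move=> mp mf; apply: bigcup_measurable => r _; exact: measurable_heavy_at.
Qed.

(** The covering argument read along the orbit of x: the centres are the group
elements of the ball of radius K that bring x into the heavy set, and each of
them comes with a radius at most N at which it is heavy. *)
Lemma heavy_orbit_sum (lam D : R) (p f : X -> R) N K x : symmetric_fset A ->
  (forall y, 0 <= p y) -> (forall y, 0 <= f y) -> 0 <= lam -> 0 <= D ->
  lam * S K (fun y => p y * \1_(heavy_upto lam D p f N) y) x <=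
  D * S (K + N) f x.
Proof.
move=> symA p0 f0 lam0 D0; set E := heavy_upto lam D p f N.
have [r rP] : exists r : G -> nat, forall h, E (T h x) ->
    (r h < N.+1)%N /\ heavy_at lam D p f (r h) (T h x).
  have /choice[r rP] : forall h, exists r, E (T h x) ->
      (r < N.+1)%N /\ heavy_at lam D p f r (T h x).
    move=> h; have [[r rN hr]|nE] := pselect (E (T h x)); last by exists 0.
    by exists r.
  by exists r.
pose J := [fset h in B K | T h x \in E]%fset.
have JE h : h \in J -> E (T h x) by rewrite !inE => /andP[_]; rewrite inE.
have -> : S K (fun y => p y * \1_E y) x = \sum_(h <- J) p (T h x).
  rewrite /ergodic_sum /J -big_fset_condE/= [RHS]big_mkcond/=.
  apply: eq_bigr => h _; rewrite indicE.
  by case: ifP; rewrite ?mulr1 ?mulr0.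
have sumT n h (w : X -> R) :
    \sum_(k <- ball_at A n h) w (T k x) = S n w (T h x).
  rewrite (@sum_ball_at _ _ _ n h (fun k => w (T k x))).
  by apply: eq_bigr => g _; rewrite (mpa_mul mpa).
apply: (@vitali_ball_sum _ _ A (fun k => p (T k x)) (fun k => f (T k x)) r) => //.
- by move=> h hJ; rewrite !sumT; have [_ [_ ?]] := rP _ (JE _ hJ).
- by move=> h hJ; rewrite !sumT; have [_ [? _]] := rP _ (JE _ hJ).
- move=> h hJ k; have [rN _] := rP _ (JE _ hJ).
  move: hJ; rewrite !inE => /andP[hK _]; rewrite mem_ball_at => kh.
  rewrite -[k](mulgVK h); apply: (@ball_subset _ _ (r h + K)).
    by rewrite addnC leq_add2l -ltnS.
  exact: mulg_mem_ball.
Qed.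

(** Transference: [heavy_orbit_sum] is integrated over x, which by invariance
multiplies the integrals by the cardinalities of the balls of radii K and
K + N; K is chosen so that their quotient is at most 2. *)
Lemma maximal_ineq_upto (lam D : R) (p f : X -> R) N : symmetric_fset A ->
  polynomial_growth R A ->
  measurable_fun [set: X] p -> measurable_fun [set: X] f ->
  (forall y, 0 <= p y) -> (forall y, 0 <= f y) -> 0 <= lam -> 0 <= D ->
  (lam%:E * \int[mu]_x (p x * \1_(heavy_upto lam D p f N) x)%:E <=
   (2 * D)%:E * \int[mu]_x (f x)%:E)%E.
Proof.
move=> symA growth mp mf p0 f0 lam0 D0.
have [K KN] := folner_ball growth N.
have mE := @measurable_heavy_upto lam D p f N mp mf.
set E := heavy_upto _ _ _ _ _ in mE *.
have K0 : (0 < #|` B K|%:R :> R).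
  by rewrite ltr0n cardfs_gt0; apply/fset0Pn; exists 1%g; exact: one_mem_ball.
have mq : measurable_fun [set: X] (fun y => p y * \1_E y).
  by apply: measurable_funM => //; exact: measurable_indic.
have q0 y : 0 <= p y * \1_E y by rewrite mulr_ge0.
have If0 : (0 <= \int[mu]_x (f x)%:E)%E by apply: integral_ge0 => x _; rewrite lee_fin.
rewrite -(@lee_pmul2l _ #|` B K|%:R%:E)//.
apply: (@le_trans _ _ (D%:E * (#|` B (K + N)|%:R%:E * \int[mu]_x (f x)%:E))%E); last first.
  rewrite !muleA -!EFinM; apply: lee_wpmul2r => //; rewrite lee_fin.
  rewrite mulrA [leLHS]mulrC ler_wpM2r// mulrC -natrM ler_nat.
  exact: KN.
rewrite muleCA -!integral_ergodic_sum// -!ge0_integralZl_EFin//; first last.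
- by apply/measurable_EFinP; exact: measurable_ergodic_sum.
- by move=> x _; rewrite lee_fin ergodic_sum_ge0.
- by apply/measurable_EFinP; exact: measurable_ergodic_sum.
- by move=> x _; rewrite lee_fin ergodic_sum_ge0.
apply: ge0_le_integral => //.
- by move=> x _; rewrite -EFinM lee_fin mulr_ge0 ?ergodic_sum_ge0.
- by apply: measurable_funeM; apply/measurable_EFinP; exact: measurable_ergodic_sum.
- by apply: measurable_funeM; apply/measurable_EFinP; exact: measurable_ergodic_sum.
- by move=> x _; rewrite -!EFinM lee_fin; exact: heavy_orbit_sum.
Qed.

Lemma maximal_ineq (lam D : R) (p f : X -> R) : symmetric_fset A ->
  polynomial_growth R A ->
  measurable_fun [set: X] p -> measurable_fun [set: X] f ->
  (forall y, 0 <= p y) -> (forall y, 0 <= f y) -> 0 <= lam -> 0 <= D ->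
  (lam%:E * \int[mu]_x (p x * \1_(heavy lam D p f) x)%:E <=
   (2 * D)%:E * \int[mu]_x (f x)%:E)%E.
Proof.
move=> symA growth mp mf p0 f0 lam0 D0.
pose q N x := (lam * (p x * \1_(heavy_upto lam D p f N) x))%:E.
have mq N : measurable_fun [set: X] (q N).
  apply/measurable_EFinP; apply: measurable_funM => //.
  apply: measurable_funM => //; apply: measurable_indic.
  exact: measurable_heavy_upto.
have q0 N x : (0 <= q N x)%E by rewrite lee_fin !mulr_ge0.
have homoq x : {homo q^~ x : m n / (m <= n)%N >-> (m <= n)%E}.
  move=> m n mn; rewrite lee_fin ler_wpM2l// ler_wpM2l//.
  rewrite !indicE ler_nat; case: (boolP (_ \in _)) => //.
  rewrite inE => -[r /= rm hr].
  by rewrite mem_set//; exists r => //=; apply: leq_trans rm _.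
have qlim x : limn (q^~ x) = (lam * (p x * \1_(heavy lam D p f) x))%:E.
  apply/cvg_lim => //.
  have [[r _ hr]|nh] := pselect (heavy lam D p f x).
    apply: cvg_near_cst; exists r => // N /= rN.
    rewrite /q !indicE !mem_set//; first by exists r.
    by exists r => //=; rewrite ltnS.
  apply: cvg_near_cst; apply: nearW => N.
  rewrite /q !indicE !memNset// => -[r _ hr]; apply: nh.
  by exists r.
rewrite -ge0_integralZl_EFin//; first last.
- apply/measurable_EFinP; apply: measurable_funM => //; apply: measurable_indic.
  exact: measurable_heavy.
- by move=> x _; rewrite lee_fin mulr_ge0.
have := cvg_monotone_convergence (mu := mu) measurableT mq (fun n x _ => q0 n x)
  (fun x _ => homoq x).
under [in X in _ --> X -> _]eq_integral do rewrite /= qlim EFinM.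
move=> /cvg_lim <- //; apply: lime_le.
  apply: ereal_nondecreasing_is_cvgn => m n mn; apply: ge0_le_integral => //.
  by move=> x _; exact: homoq.
apply: nearW => N; rewrite /q.
under eq_integral do rewrite EFinM.
rewrite ge0_integralZl_EFin//; first exact: maximal_ineq_upto.
  by move=> x _; rewrite lee_fin mulr_ge0.
apply/measurable_EFinP; apply: measurable_funM => //; apply: measurable_indic.
exact: measurable_heavy_upto.
Qed.

End MaximalInequality.

End Actions.

(** * Greedy transport between functions of equal integral *)
Section Transport.
Context {R : realType} {d : measure_display} {X : measurableType d} {G : groupType}.
Variables (mu : {measure set X -> \bar R}) (T : G -> X -> X).
Hypothesis mpa : measure_preserving_action mu T.

Lemma translateK g x : T (g^-1)%g (T g x) = x.
Proof. by rewrite -(mpa_mul mpa) mulVg (mpa_one mpa). Qed.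

Lemma translateVK g x : T g (T (g^-1)%g x) = x.
Proof. by rewrite -(mpa_mul mpa) mulgV (mpa_one mpa). Qed.

Variables (f psi : X -> R) (e : nat -> G).

(** The pair of masses not yet moved from f and not yet received by psi after
the elements e 0, ..., e (n-1) have been used.  At stage m, as much as possible
is moved from x to T (e m) x. *)
Fixpoint residual (n : nat) : (X -> R) * (X -> R) :=
  if n is m.+1 then
    let u x := Num.min ((residual m).1 x) ((residual m).2 (T (e m) x)) in
    (fun x => (residual m).1 x - u x,
     fun y => (residual m).2 y - u (T (e m)^-1%g y))
  else (f, psi).

Definition moved (n : nat) (x : X) : R :=
  Num.min ((residual n).1 x) ((residual n).2 (T (e n) x)).

Lemma residual_src n x : (residual n.+1).1 x = (residual n).1 x - moved n x.
Proof. by []. Qed.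

Lemma residual_tgt n y :
  (residual n.+1).2 y = (residual n).2 y - moved n (T (e n)^-1%g y).
Proof. by []. Qed.

Lemma residual_sum n x :
  f x = (residual n).1 x + \sum_(j < n) moved j x /\
  psi x = (residual n).2 x + \sum_(j < n) moved j (T (e j)^-1%g x).
Proof.
elim: n => [|n [-> ->]]; first by rewrite !big_ord0 !addr0.
by rewrite !big_ord_recr residual_src residual_tgt /=; split; ring.
Qed.

Hypotheses (f0 : forall x, 0 <= f x) (psi0 : forall x, 0 <= psi x).
Hypotheses (mf : measurable_fun [set: X] f) (mpsi : measurable_fun [set: X] psi).

Lemma residual_ge0 n x : 0 <= (residual n).1 x /\ 0 <= (residual n).2 x.
Proof.
elim: n x => [//|n IHn] x; rewrite residual_src residual_tgt !subr_ge0; split.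
  by rewrite ge_min lexx.
by rewrite ge_min translateVK lexx orbT.
Qed.

Lemma moved_ge0 n x : 0 <= moved n x.
Proof. by rewrite le_min (residual_ge0 _ _).1 (residual_ge0 _ _).2. Qed.

Lemma residual_le m n x : (m <= n)%N ->
  (residual n).1 x <= (residual m).1 x /\ (residual n).2 x <= (residual m).2 x.
Proof.
move=> /subnK <-; elim: (n - m)%N => [//|k [IH1 IH2]].
rewrite addSn residual_src residual_tgt; split.
  by apply: le_trans IH1; rewrite lerBlDr lerDl moved_ge0.
by apply: le_trans IH2; rewrite lerBlDr lerDl moved_ge0.
Qed.

Lemma moved_le n x : moved n x <= f x.
Proof.
apply: (@le_trans _ _ ((residual n).1 x)); first by rewrite ge_min lexx.
exact: (residual_le x (leq0n n)).1.
Qed.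

Lemma measurable_residual n : measurable_fun [set: X] (residual n).1 /\
  measurable_fun [set: X] (residual n).2.
Proof.
elim: n => [//|n [m1 m2]].
have mm : measurable_fun [set: X] (moved n).
  by apply: measurable_minr => //; exact: (measurable_translate mpa (e n) m2).
by split; apply: measurable_funB => //; exact: (measurable_translate mpa (e n)^-1%g mm).
Qed.

Lemma measurable_moved n : measurable_fun [set: X] (moved n).
Proof.
have [m1 m2] := measurable_residual n.
by apply: measurable_minr => //; exact: (measurable_translate mpa (e n) m2).
Qed.

Hypothesis int_f : mu.-integrable [set: X] (EFin \o f).
Hypothesis int_eq : (\int[mu]_x (f x)%:E = \int[mu]_x (psi x)%:E)%E.

Lemma integral_residual n :
  (\int[mu]_x ((residual n).1 x)%:E = \int[mu]_x ((residual n).2 x)%:E)%E.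
Proof.
elim: n => [//|n IHn].
have [mr1 mr2] := measurable_residual n.+1; have mm := measurable_moved n.
have mm' := measurable_translate mpa (e n)^-1%g mm.
have src : (\int[mu]_x ((residual n).1 x)%:E =
    \int[mu]_x ((residual n.+1).1 x)%:E + \int[mu]_x (moved n x)%:E)%E.
  rewrite -ge0_integralD//; first last.
  - exact/measurable_EFinP.
  - by move=> x _; rewrite lee_fin moved_ge0.
  - exact/measurable_EFinP.
  - by move=> x _; rewrite lee_fin (residual_ge0 _ _).1.
  by apply: eq_integral => x _; rewrite -EFinD residual_src subrK.
have tgt : (\int[mu]_x ((residual n).2 x)%:E =
    \int[mu]_x ((residual n.+1).2 x)%:E + \int[mu]_x (moved n x)%:E)%E.
  rewrite -[X in (_ = _ + X)%E](integral_translate mpa (e n)^-1%g (f := EFin \o moved n));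
    first last.
  - by move=> x; rewrite lee_fin moved_ge0.
  - exact/measurable_EFinP.
  rewrite -ge0_integralD//; first last.
  - exact/measurable_EFinP.
  - by move=> x _; rewrite lee_fin moved_ge0.
  - exact/measurable_EFinP.
  - by move=> x _; rewrite lee_fin (residual_ge0 _ _).2.
  by apply: eq_integral => x _; rewrite -EFinD residual_tgt subrK.
have fin : (\int[mu]_x (moved n x)%:E \is a fin_num)%E.
  rewrite ge0_fin_numE; last by apply: integral_ge0 => x _; rewrite lee_fin moved_ge0.
  have /integrableP[_] := int_f; apply: le_lt_trans.
  apply: ge0_le_integral => //.
  - by move=> x _; rewrite lee_fin moved_ge0.
  - exact/measurable_EFinP.
  - by apply/measurable_EFinP; exact: measurableT_comp.
  - by move=> x _ /=; rewrite lee_fin ger0_norm// moved_le.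
by move: IHn; rewrite src tgt => IHn; rewrite -[LHS](addeK _ fin) IHn addeK.
Qed.

(** Pointwise limit of the first (k = fst) or second (k = snd) residual, an
infimum because both decrease. *)
Definition residual_lim (k : (X -> R) * (X -> R) -> X -> R) x : R :=
  inf (range (fun n => k (residual n) x)).

Lemma residual_lim_cvg x :
  (residual n).1 x @[n --> \oo] --> residual_lim fst x /\
  (residual n).2 x @[n --> \oo] --> residual_lim snd x.
Proof.
split; apply: nonincreasing_cvgn; try by move=> m n /(residual_le x)[].
  by exists 0 => _ [n _ <-]; exact: (residual_ge0 n x).1.
by exists 0 => _ [n _ <-]; exact: (residual_ge0 n x).2.
Qed.

Lemma residual_lim_ge0 x : 0 <= residual_lim fst x /\ 0 <= residual_lim snd x.
Proof.
split; apply: lb_le_inf.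
- by exists (f x); exists 0%N.
- by move=> _ [n _ <-]; exact: (residual_ge0 n x).1.
- by exists (psi x); exists 0%N.
- by move=> _ [n _ <-]; exact: (residual_ge0 n x).2.
Qed.

Lemma residual_lim_le n x :
  residual_lim fst x <= (residual n).1 x /\ residual_lim snd x <= (residual n).2 x.
Proof.
split; (apply: ge_inf; last by exists n).
  by exists 0 => _ [k _ <-]; exact: (residual_ge0 k x).1.
by exists 0 => _ [k _ <-]; exact: (residual_ge0 k x).2.
Qed.

Hypothesis e_surj : forall g, exists n, e n = g.

(** Maximality of the transport: if mass is left at x for ever, some was left
when g was used, so that the demand at T g x was satisfied then. *)
Lemma residual_lim_excl g x : 0 < residual_lim fst x -> residual_lim snd (T g x) = 0.
Proof.
have [n <-] := e_surj g => lt0; apply/eqP; rewrite eq_le (residual_lim_ge0 _).2 andbT.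
have := lt_le_trans lt0 (residual_lim_le n.+1 x).1.
apply: contraTT; rewrite -ltNge -leNgt => /lt_le_trans/(_ (residual_lim_le n.+1 _).2).
rewrite residual_src residual_tgt translateK !subr_gt0 subr_le0 /moved gt_min ltxx orbF.
by move=> h; rewrite le_min lexx ltW.
Qed.

Hypothesis ergodic : ergodic_action mu T.
Hypothesis int_psi : mu.-integrable [set: X] (EFin \o psi).

(** The saturation of the set where mass is left is invariant, hence null or
conull; in the second case [residual_lim_excl] leaves no demand anywhere. *)
Lemma residual_lim_null :
  {ae mu, forall x, residual_lim fst x = 0} \/ {ae mu, forall x, residual_lim snd x = 0}.
Proof.
have ma : measurable_fun [set: X] (residual_lim fst).
  apply: (@measurable_fun_cvg _ _ _ _ (fun n => (residual n).1)) => [n|x _].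
    exact: (measurable_residual n).1.
  exact: (residual_lim_cvg x).1.
pose P := [set x | exists g, 0 < residual_lim fst (T g x)].
have mP : measurable P.
  have -> : P = \bigcup_n [set x | 0 < residual_lim fst (T (e n) x)].
    apply/seteqP; split=> x [] => [g|n _ /=]; last by exists (e n).
    by have [n <-] := e_surj g; exists n.
  apply: bigcup_measurable => n _.
  rewrite (_ : [set x | _] = ~` [set x | residual_lim fst (T (e n) x) <= 0]).
    apply: measurableC; apply: measurable_ler_set => //.
    exact: (measurable_translate mpa (e n) ma).
  by apply/seteqP; split=> x /=; rewrite ltNge => /negP.
have inv g : T g @^-1` P = P.
  apply/seteqP; split=> x [h hx].
    by exists (h * g)%g; rewrite (mpa_mul mpa).
  by exists (h * g^-1)%g; rewrite -(mpa_mul mpa) mulgVK.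
case: (ergodic mP inv) => P0; [left|right].
  exists P; split=> // x /= /eqP; rewrite neq_lt ltNge (residual_lim_ge0 _).1 /= => h.
  by exists 1%g; rewrite (mpa_one mpa).
exists (~` P); split=> //; first exact: measurableC.
move=> x /= hx [g gx]; apply: hx.
by rewrite -[x](translateK g); exact: residual_lim_excl.
Qed.

(** It does not matter which of the two residuals vanishes in the limit, since
their integrals agree at every stage. *)
Lemma integral_residual_cvg0 :
  (\int[mu]_x ((residual n).1 x)%:E)%E @[n --> \oo] --> 0%E.
Proof.
have aux (h : nat -> X -> R) (h' k : X -> R) : (forall n, measurable_fun [set: X] (h n)) ->
    (forall n x, 0 <= h n x <= k x) -> mu.-integrable [set: X] (EFin \o k) ->
    (forall x, h n x @[n --> \oo] --> h' x) -> {ae mu, forall x, h' x = 0} ->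
    (\int[mu]_x (h n x)%:E)%E @[n --> \oo] --> 0%E.
  move=> mh hk ik hh' h'0.
  have := @dominated_cvg _ _ _ mu setT measurableT (fun n => EFin \o h n) (EFin \o h')
    (EFin \o k).
  have -> : (\int[mu]_x (EFin \o h') x = 0)%E.
    rewrite (@ae_eq_integral _ _ _ mu setT (cst 0%E))//; first exact: integral0.
      by apply/measurable_EFinP; exact: (@measurable_fun_cvg _ _ _ _ h).
    by apply: filterS h'0 => x /= -> _.
  apply=> //.
  - by move=> n; apply/measurable_EFinP; exact: mh.
  - move=> x _; apply: cvg_EFin; first exact: nearW.
    exact: (hh' x).
  - move=> n x _ /=; rewrite lee_fin; have /andP[h0 hle] := hk n x.
    by rewrite ger0_norm.
case: residual_lim_null => null.
  apply: (aux _ (residual_lim fst) f) => // [n|n x|x].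
  - exact: (measurable_residual n).1.
  - by rewrite (residual_ge0 _ _).1 (residual_le x (leq0n n)).1.
  - exact: (residual_lim_cvg x).1.
rewrite (_ : (fun n => _) = (fun n => \int[mu]_x ((residual n).2 x)%:E)%E); last first.
  by apply/funext => n; exact: integral_residual.
apply: (aux _ (residual_lim snd) psi) => // [n|n x|x].
- exact: (measurable_residual n).2.
- by rewrite (residual_ge0 _ _).2 (residual_le x (leq0n n)).2.
- exact: (residual_lim_cvg x).2.
Qed.

End Transport.

(** * Integrable functions on a sigma-finite space *)
Section SummableFunctions.
Context {R : realType} {d : measure_display} {X : measurableType d}.
Variable mu : {measure set X -> \bar R}.

(** The pointwise series of the h n has an integral at most c, hence is finite
almost everywhere, and it bounds each of its terms. *)
Lemma ae_bounded_of_summable (h : nat -> X -> R) (c : R) :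
  (forall n, measurable_fun [set: X] (h n)) -> (forall n x, 0 <= h n x) -> 0 <= c ->
  (forall n, (\int[mu]_x (h n x)%:E <= (c / (2 ^ n.+1)%:R)%:E)%E) ->
  {ae mu, forall x, exists C, forall n, h n x <= C}.
Proof.
move=> mh h0 c0 hc; pose f x := (\sum_(0 <= n <oo) (h n x)%:E)%E.
have mhE n : measurable_fun [set: X] (fun x => (h n x)%:E) by exact/measurable_EFinP.
have hE n x : setT x -> (0 <= (h n x)%:E)%E by rewrite lee_fin.
have f0 x : (0 <= f x)%E by apply: nneseries_ge0 => n _ _; exact: hE.
have If : mu.-integrable [set: X] f.
  apply/integrableP; split.
    by apply: ge0_emeasurable_sum => // n x _ _; exact: hE.
  under eq_integral do rewrite gee0_abs//.
  rewrite (integral_nneseries mu measurableT mhE hE).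
  apply: le_lt_trans (ltry c); apply: le_trans (epsilon_trick0 xpredT c0).
  by apply: lee_nneseries => // n _ _; apply: integral_ge0 => x _; exact: hE.
have := integrable_ae measurableT If; apply: filterS => x /(_ I) fx.
exists (fine (f x)) => n; rewrite -lee_fin fineK//.
apply: le_trans (@nneseries_lim_ge _ (fun k => (h k x)%:E) xpredT 0 n.+1 _); last first.
  by move=> k _ _; exact: hE.
by rewrite big_nat_recr//= leeDr//; apply: sume_ge0 => k _; exact: hE.
Qed.

(** A weighted sum of the indicators of the sets F n of a cover by sets of finite
measure: the factor 2 ^- n.+1 makes it finite everywhere, and the factor
1 / (1 + mu (F n)) makes it integrable. *)
Lemma exists_pos_integrable : sigma_finite [set: X] mu ->
  exists p : X -> R, [/\ measurable_fun [set: X] p, forall x, 0 < p x &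
    mu.-integrable [set: X] (EFin \o p)].
Proof.
move=> [F FT FP].
pose w n : R := (1 / (2 ^ n.+1)%:R) / (1 + fine (mu (F n))).
have w1 n : 0 < 1 + fine (mu (F n)) by rewrite ltr_pwDl// fine_ge0.
have w0 n : 0 < w n by rewrite divr_gt0// divr_gt0// ltr0n expn_gt0.
have w2 n : w n <= 1 / (2 ^ n.+1)%:R.
  by rewrite ler_piMr// ?divr_ge0// invf_le1// lerDl fine_ge0.
pose h n x : R := w n * \1_(F n) x.
have mh n : measurable_fun [set: X] (h n).
  by apply: measurable_funM => //; apply: measurable_indic; exact: (FP n).1.
have h0 n x : 0 <= h n x by rewrite mulr_ge0// ltW.
pose f x := (\sum_(0 <= n <oo) (h n x)%:E)%E.
have mhE n : measurable_fun [set: X] (fun x => (h n x)%:E) by exact/measurable_EFinP.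
have hE n x : setT x -> (0 <= (h n x)%:E)%E by rewrite lee_fin.
have f0 x : (0 <= f x)%E by apply: nneseries_ge0 => n _ _; exact: hE.
have f1 x : (f x <= 1%:E)%E.
  apply: le_trans (epsilon_trick0 xpredT ler01).
  apply: lee_nneseries => [n _ _|n _]; first exact: hE.
  rewrite lee_fin; apply: le_trans (w2 n).
  by rewrite ler_piMr ?(ltW (w0 n))// indicE lern1 leq_b1.
have ffin x : f x \is a fin_num by rewrite ge0_fin_numE// (le_lt_trans (f1 x))// ltry.
have mfE : measurable_fun [set: X] f.
  by apply: ge0_emeasurable_sum => // n x _ _; exact: hE.
have fE : EFin \o (fine \o f) = f by apply/funext => x /=; rewrite fineK.
exists (fine \o f); split.
- by apply/measurable_EFinP; rewrite fE.
- move=> x; have [n _ Fx] : (\bigcup_i F i) x by rewrite -FT.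
  rewrite /= -lte_fin fineK//.
  apply: lt_le_trans (@nneseries_lim_ge _ (fun k => (h k x)%:E) xpredT 0 n.+1 _);
    last by move=> k _ _; exact: hE.
  rewrite big_nat_recr//=; apply: (@lt_le_trans _ _ (h n x)%:E).
    by rewrite lte_fin /h indicE mem_set// mulr1.
  by rewrite leeDr//; apply: sume_ge0 => k _; exact: hE.
- rewrite fE; apply/integrableP; split=> //.
  under eq_integral do rewrite gee0_abs//.
  rewrite (integral_nneseries mu measurableT mhE hE).
  apply: le_lt_trans (ltry 1); apply: le_trans (epsilon_trick0 xpredT ler01).
  apply: lee_nneseries => [n _ _|n _].
    by apply: integral_ge0 => x _; exact: hE.
  rewrite /h; under eq_integral do rewrite EFinM.
  rewrite ge0_integralZl_EFin ?(ltW (w0 n))//; first last.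
    by apply/measurable_EFinP; apply: measurable_indic; exact: (FP n).1.
  rewrite integral_indic ?setIT//; last exact: (FP n).1.
  rewrite -(@fineK _ (mu (F n))); last by rewrite ge0_fin_numE//; exact: (FP n).2.
  by rewrite -EFinM lee_fin /w mulrAC -mulrA ler_piMr// ?divr_ge0// ler_pdivrMr// mul1r lerDr.
Qed.

End SummableFunctions.

Lemma enumerate_group {G : groupType} (A : {fset G}) : symmetric_fset A -> generates A ->
  exists e : nat -> G, forall g, exists n, e n = g.
Proof.
move=> symA genA.
exists (fun k => if (choice.unpickle k : option (nat * nat)) is Some (n, i)
  then nth 1%g (enum_fset (word_ball A n)) i else 1%g) => g.
have [n gn] := mem_some_ball symA genA g.
exists (choice.pickle (n, index g (enum_fset (word_ball A n)))).
by rewrite choice.pickleK nth_index.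
Qed.

Lemma leq_exp2r_homo m n k : (m <= n)%N -> (m ^ k <= n ^ k)%N.
Proof. by case: k => // k mn; rewrite leq_exp2r. Qed.

(** * The radii *)
Section Radius.
Local Notation rt := PeanoNat.Nat.sqrt.

(** These radii are strictly increasing with subexponential growth
exp (O(sqrt i)), and double when i is increased by O(sqrt i). *)
Definition slow_radius (i : nat) : nat := (i + 4 ^ rt i)%N.

Lemma slow_radius_add i k : (slow_radius i + k <= slow_radius (i + k))%N.
Proof. by rewrite /slow_radius addnAC leq_add2l leq_exp2l// leq_sqrtn// leq_addr. Qed.

Lemma slow_radius_lt i j : (i < j)%N -> (slow_radius i < slow_radius j)%N.
Proof.
move=> ij; rewrite -(subnKC (ltnW ij)); apply: leq_trans (slow_radius_add _ _).
by rewrite -addn1 leq_add2l subn_gt0.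
Qed.

Lemma slow_radius_le i j : (i <= j)%N -> (slow_radius i <= slow_radius j)%N.
Proof. by rewrite leq_eqVlt => /predU1P[->//|/slow_radius_lt/ltnW]. Qed.

Lemma slow_radius_double i : (2 * slow_radius i <= slow_radius (i + (4 * rt i + 4)))%N.
Proof.
set s := rt i; set m := (i + _)%N.
have sm : (s + 2 <= rt m)%N by have := sqrtn_le i; have := sqrtn_gt m; rewrite /m -/s; nia.
have : (4 ^ (s + 2) <= 4 ^ rt m)%N by rewrite leq_exp2l.
have s2 : (s * s <= 4 ^ s)%N.
  by rewrite (_ : 4 = 2 * 2)%N// expnMn leq_mul// ltnW// ltn_expl.
have := sqrtn_gt i; rewrite -/s /slow_radius -/s expnD; rewrite /m; nia.
Qed.

Lemma slow_radius_sqr_growth {R : realType} {G : groupType} (A : {fset G}) :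
  polynomial_growth R A ->
  exists2 Q : nat, (0 < Q)%N &
    forall s, (#|` word_ball A (slow_radius (s * s))| <= Q ^ s.+1)%N.
Proof.
move=> /polynomial_growth_nat[K [k growth]].
exists (K * 2 ^ k * 4 ^ k + 4 ^ k)%N; first by rewrite addn_gt0 [X in _ || X]expn_gt0 orbT.
move=> s; rewrite /slow_radius sqrtn_sqr.
apply: leq_trans (growth _ _) _; first by rewrite addn_gt0 expn_gt0 orbT.
have s2 : (s * s <= 4 ^ s)%N.
  by rewrite (_ : 4 = 2 * 2)%N// expnMn leq_mul// ltnW// ltn_expl.
apply: (@leq_trans (K * (2 * 4 ^ s) ^ k)).
  by rewrite leq_mul2l leq_exp2r_homo ?orbT// mul2n -addnn leq_add2r.
rewrite expnMn mulnA -expnM [(s * k)%N]mulnC expnM expnS leq_mul//.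
  by rewrite (@leq_trans (K * 2 ^ k * 4 ^ k))// ?leq_addr// leq_pmulr// expn_gt0.
by rewrite leq_exp2r_homo// leq_addl.
Qed.

End Radius.

(** * Good scales along an orbit *)
Section SlowScales.
Context {R : realType} (V : nat -> R) (C : R) (Q : nat).
Hypothesis V_gt0 : 0 < V 0.
Hypothesis V_mono : forall m n : nat, (m <= n)%N -> V m <= V n.
Hypothesis Q_gt1 : (1 < Q)%N.
Hypothesis V_growth : forall s, V (slow_radius (s * s)%N) <= C * Q%:R ^+ s.+1.
Local Notation rt := PeanoNat.Nat.sqrt.

Let Vpos n : 0 < V n.
Proof. by apply: lt_le_trans V_gt0 (V_mono _). Qed.

Let a i : R := ln (V (slow_radius i)).

Let a_mono i j : (i <= j)%N -> a i <= a j.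
Proof. by move=> ij; rewrite ler_ln ?posrE// V_mono// slow_radius_le. Qed.

Let lnQ_gt0 : 0 < ln Q%:R :> R.
Proof. by rewrite ln_gt0// ltr1n. Qed.

Let a_sqrt i : a i <= (ln C + 2 * ln Q%:R) + ln Q%:R * (rt i)%:R.
Proof.
have Qs_gt0 s : 0 < Q%:R ^+ s :> R by rewrite exprn_gt0// ltr0n ltnW.
have C_gt0 : 0 < C.
  by rewrite -(pmulr_lgt0 _ (Qs_gt0 1)); apply: lt_le_trans (Vpos _) (V_growth 0).
apply: (@le_trans _ _ (a ((rt i).+1 * (rt i).+1)%N)).
  by apply: a_mono; exact/ltnW/sqrtn_gt.
apply: (@le_trans _ _ (ln (C * Q%:R ^+ (rt i).+2))).
  by rewrite ler_ln ?posrE// mulr_gt0.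
rewrite lnM ?posrE// lnXn ?ltr0n ?(ltnW Q_gt1)// -mulr_natl -addrA lerD2l.
by rewrite -natr1 -natr1; lra.
Qed.

(** The shell around n(i) lies between n(i-k) and n(i+k), as the radii are
strictly increasing; so its weight is governed by a lag-2k increment of the
logarithm. *)
Lemma shell_density_zero (k : nat) (delta : R) : 0 < delta ->
  density_zero (R := R)
    [set i | delta * V (slow_radius i) < V (slow_radius i + k)%N - V (slow_radius i - k)%N].
Proof.
move=> delta0; have l0 : 0 < ln (1 + delta) by rewrite ln_gt0// ltrDl.
apply: (@density_zero_shift _ _ _ k _ (jumps_density_zero a_mono lnQ_gt0 a_sqrt (k + k) l0)).
move=> i ki /=; apply: contraTT; rewrite -!leNgt => h.
have up : V (slow_radius i + k)%N <= V (slow_radius (i - k + (k + k))).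
  apply: V_mono; apply: leq_trans (slow_radius_add _ _) _; apply: slow_radius_le; lia.
have down : V (slow_radius (i - k)) <= V (slow_radius i - k)%N.
  apply: V_mono; have := slow_radius_add (i - k) k; rewrite subnK ?(ltnW ki)//; lia.
have step : V (slow_radius (i - k + (k + k))) <= (1 + delta) * V (slow_radius (i - k)).
  rewrite -ler_ln ?posrE ?mulr_gt0 ?addr_gt0// lnM ?posrE ?addr_gt0//.
  by move: h; rewrite /a; lra.
have le : V (slow_radius (i - k)) <= V (slow_radius i).
  by rewrite V_mono// slow_radius_le// leq_subr.
by have := ler_wpM2l (ltW delta0) le; lra.
Qed.

(** The constant expR (5 * ln Q / e) involves neither C nor V 0, the only data
that depend on the orbit.  This uniformity is what allows the same maximal
inequality to be applied at almost every point. *)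
Lemma doubling_density_le (e : R) : 0 < e ->
  density_le (R := R)
    [set i | expR (5 * ln Q%:R / e) * V (slow_radius i) < V (2 * slow_radius i)%N] e.
Proof.
move=> e0; set eta := 5 * ln Q%:R / e.
have eta0 : 0 < eta by rewrite divr_gt0// mulr_gt0.
have -> : e = 5 * ln Q%:R / eta.
  by rewrite /eta; field; rewrite (gt_eqF lnQ_gt0) (gt_eqF e0).
apply: sub_density_le (big_jumps_density_le a_mono lnQ_gt0 a_sqrt eta0) => i /=.
have D0 : 0 < expR eta * V (slow_radius i) by rewrite mulr_gt0 ?expR_gt0.
move=> h; have := lt_le_trans h (V_mono (slow_radius_double i)).
by rewrite -ltr_ln ?posrE// lnM ?posrE ?expR_gt0// expRK /a; lra.
Qed.

End SlowScales.

(** * The ratio theorem *)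
Section RatioTheorem.
Context {R : realType} {d : measure_display} {X : measurableType d} {G : groupType}.
Variables (mu : {measure set X -> \bar R}) (T : G -> X -> X) (A : {fset G}).
Hypotheses (mpa : measure_preserving_action mu T) (symA : symmetric_fset A).
Local Notation B := (word_ball A).
Local Notation S n f x := (ergodic_sum T (B n) f x).

Lemma ergodic_sum_translate (g : G) n (f : X -> R) x :
  S n (f \o T g) x = \sum_(h <- [fset (g * h)%g | h in B n]%fset) f (T h x).
Proof.
rewrite big_imfset => [|h k _ _]; last exact: mulgI.
by apply: eq_bigr => h _ /=; rewrite (mpa_mul mpa).
Qed.

(** The sums of u over the ball of radius n and over its left translate by g both
lie between the sums over the balls of radii n - k and n + k. *)
Lemma coboundary_le_shell (p u : X -> R) (K : R) (k n : nat) (g : G) x :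
  (forall y, 0 <= u y <= K * p y) -> g \in B k -> (k <= n)%N ->
  `|S n u x - S n (u \o T g) x| <= K * (S (n + k) p x - S (n - k) p x).
Proof.
move=> up gk kn.
have u0 h : 0 <= u (T h x) by have /andP[] := up (T h x).
have sub0 : {subset B (n - k) <= B (n + k)} by apply: ball_subset; lia.
have lo1 : S (n - k) u x <= S n u x.
  by apply: sum_fset_subset => //; apply: ball_subset; lia.
have hi1 : S n u x <= S (n + k) u x.
  by apply: sum_fset_subset => //; apply: ball_subset; lia.
have lo2 : S (n - k) u x <= S n (u \o T g) x.
  rewrite ergodic_sum_translate; apply: sum_fset_subset => // h hB.
  apply/imfsetP; exists (g^-1 * h)%g => /=; last by rewrite mulVKg.
  rewrite -(subnKC kn); apply: mulg_mem_ball => //; exact: invg_mem_ball.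
have hi2 : S n (u \o T g) x <= S (n + k) u x.
  rewrite ergodic_sum_translate; apply: sum_fset_subset => // h.
  by move=> /imfsetP[h' /= hB ->]; rewrite addnC; exact: mulg_mem_ball.
have shell : S (n + k) u x - S (n - k) u x <= K * (S (n + k) p x - S (n - k) p x).
  rewrite /ergodic_sum (sum_fsetD (fun h => u (T h x)) sub0).
  rewrite (sum_fsetD (fun h => p (T h x)) sub0) ![_ + _ - _]addrAC !subrr !add0r mulr_sumr.
  by apply: ler_sum => h _; have /andP[] := up (T h x).
by rewrite ler_norml; apply/andP; split; lra.
Qed.

Lemma ergodic_sum_ball_gt0 (p : X -> R) n x : (forall y, 0 < p y) -> 0 < S n p x.
Proof.
move=> p_gt0; apply: (@lt_le_trans _ _ (S 0 p x)).
  by rewrite /ergodic_sum /= big_seq_fset1.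
by apply: sum_fset_subset => [g|]; [exact: ltW|exact: ball_subset].
Qed.

Variable p : X -> R.
Hypotheses (mp : measurable_fun [set: X] p) (p_gt0 : forall x, 0 < p x)
  (int_p : mu.-integrable [set: X] (EFin \o p)).
Hypotheses (genA : generates A) (growth : polynomial_growth R A).

Let p_ge0 x : 0 <= p x. Proof. exact/ltW. Qed.

Let Ip_fin : (\int[mu]_x (p x)%:E \is a fin_num)%E.
Proof. exact: integrable_fin_num. Qed.

(** The integral of S_r p is |B_r| times that of p; dividing by (2 Q)^(s+1)
instead of Q^(s+1) makes these integrals summable in s. *)
Lemma orbit_growth : exists2 Q : nat, (1 < Q)%N &
  {ae mu, forall x, exists C, forall s, S (slow_radius (s * s)%N) p x <= C * Q%:R ^+ s.+1}.
Proof.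
have [Q Q0 HQ] := slow_radius_sqr_growth growth; exists (2 * Q)%N; first by lia.
have Qs s : 0 < (2 * Q)%:R ^+ s.+1 :> R by rewrite exprn_gt0// ltr0n muln_gt0.
pose h s x := S (slow_radius (s * s)%N) p x / (2 * Q)%:R ^+ s.+1.
have : {ae mu, forall x, exists C, forall s, h s x <= C}.
  apply: (@ae_bounded_of_summable _ _ _ mu h (fine (\int[mu]_x (p x)%:E))%E) => [s|s x||s].
  - by apply: measurable_funM => //; exact: (measurable_ergodic_sum mpa).
  - by rewrite divr_ge0 ?ergodic_sum_ge0// ltW.
  - by apply: fine_ge0; apply: integral_ge0 => x _; rewrite lee_fin.
  rewrite /h; under eq_integral do rewrite mulrC EFinM.
  rewrite ge0_integralZl_EFin//; first last.
  - by apply/measurable_EFinP; exact: (measurable_ergodic_sum mpa).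
  - by move=> x _; rewrite lee_fin ergodic_sum_ge0.
  rewrite integral_ergodic_sum// -(fineK Ip_fin) -!EFinM lee_fin /=.
  set I := fine _.
  have I0 : 0 <= I by apply: fine_ge0; apply: integral_ge0 => x _; rewrite lee_fin.
  have QE : (2 * Q)%:R ^+ s.+1 = (2 ^ s.+1)%:R * (Q ^ s.+1)%:R :> R.
    by rewrite -natrX -natrM expnMn.
  rewrite mulrA [leLHS]mulrC ler_wpM2l// mulrC ler_pdivrMr// QE.
  by rewrite mulKf ?pnatr_eq0 ?expn_eq0// ler_nat.
apply: filterS => x [C hC]; exists C => s.
by rewrite -ler_pdivrMr//; exact: hC.
Qed.

(** By the maximal inequality, the intersection of the heavy sets has p-measure
at most 2 D / lam times the integral of f n, for every n. *)
Lemma heavy_null (lam D : R) (f : nat -> X -> R) : 0 < lam -> 0 <= D ->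
  (forall n, measurable_fun [set: X] (f n)) -> (forall n x, 0 <= f n x) ->
  (\int[mu]_x (f n x)%:E)%E @[n --> \oo] --> 0%E ->
  {ae mu, forall x, exists n, ~ heavy T A lam D p (f n) x}.
Proof.
move=> lam0 D0 mf f0 fcvg; pose N := \bigcap_n heavy T A lam D p (f n).
have mN : measurable N by apply: bigcap_measurable => // n _; exact: (measurable_heavy mpa).
have mpN : measurable_fun [set: X] (fun x => p x * \1_N x).
  by apply: measurable_funM => //; exact: measurable_indic.
have IN0 : (\int[mu]_x (p x * \1_N x)%:E = 0)%E.
  apply/eqP; rewrite eq_le; apply/andP; split; last first.
    by apply: integral_ge0 => x _; rewrite lee_fin mulr_ge0.
  rewrite -(@lee_pmul2l _ lam%:E)// mule0.
  have lim0 : ((2 * D)%:E * \int[mu]_x (f n x)%:E)%E @[n --> \oo] --> 0%E.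
    by rewrite -[X in _ --> X](mule0 (2 * D)%:E); apply: cvgeZl.
  rewrite -(cvg_lim _ lim0)//; apply: lime_ge; first by apply/cvg_ex; exists 0%E.
  apply: nearW => n.
  apply: le_trans (maximal_ineq mpa symA growth mp (mf n) p_ge0 (f0 n) (ltW lam0) D0).
  apply: lee_wpmul2l; first by rewrite lee_fin ltW.
  apply: ge0_le_integral => //.
  - by move=> x _; rewrite lee_fin mulr_ge0.
  - exact/measurable_EFinP.
  - apply/measurable_EFinP; apply: measurable_funM => //; apply: measurable_indic.
    exact: (measurable_heavy mpa).
  - move=> x _; rewrite lee_fin ler_wpM2l// !indicE ler_nat.
    case: (boolP (x \in N)) => //; rewrite inE => Nx.
    by rewrite mem_set//; exact: Nx.
have := (ae_eq_integral_abs mu measurableT ((measurable_EFinP _ _).2 mpN)).1.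
have -> : (\int[mu]_x `|(p x * \1_N x)%:E| = 0)%E.
  by rewrite -IN0; apply: eq_integral => x _; rewrite gee0_abs// lee_fin mulr_ge0.
move=> /(_ erefl); apply: filterS => x /= /(_ I) [] px.
have Nx : ~ N x.
  by move=> Nx; move: px; apply/eqP; rewrite indicE mem_set// mulr1 gt_eqF.
apply: contrapT => /forallNP h; apply: Nx => n _.
exact: contrapT (h n).
Qed.

Hypothesis ergodic : ergodic_action mu T.

(** The greedy transport of f to c p, stopped at stage J, splits the deviation
of the ratio from c into z, which comes from finitely many coboundaries and
tends to 0 in density, and the contribution of the residuals, which is small at
doubling radii as soon as x lies outside the heavy set of their sum h J. *)
Lemma ratio_cvgd_dominated (f : X -> R) (K : R) : measurable_fun [set: X] f ->
  (forall x, 0 <= f x <= K * p x) -> (0 < \int[mu]_x (p x)%:E)%E ->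
  {ae mu, forall x, cvgd (fun i => S (slow_radius i) f x / S (slow_radius i) p x)
    (fine (\int[mu]_x (f x)%:E) / fine (\int[mu]_x (p x)%:E))}.
Proof.
move=> mf fK Ip_gt0.
have f0 x : 0 <= f x by have /andP[] := fK x.
have int_f : mu.-integrable [set: X] (EFin \o f).
  apply: (@le_integrable _ _ _ _ _ _ _ (EFin \o (fun x => K * p x))) => //.
  - exact/measurable_EFinP.
  - move=> x _ /=; rewrite lee_fin ger0_norm// ger0_norm; first by have /andP[] := fK x.
    by have /andP[] := fK x; exact: le_trans.
  - exact: (integrableZl measurableT K int_p).
set If := fine (\int[mu]_x (f x)%:E); set Ip := fine (\int[mu]_x (p x)%:E).
have Ip0 : 0 < Ip by rewrite fine_gt0// Ip_gt0 ltey_eq Ip_fin.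
have If0 : 0 <= If by apply: fine_ge0; apply: integral_ge0 => x _; rewrite lee_fin.
set c := If / Ip; have c0 : 0 <= c by rewrite divr_ge0// ltW.
pose psi x := c * p x.
have psi0 x : 0 <= psi x by rewrite mulr_ge0.
have mpsi : measurable_fun [set: X] psi by exact: measurable_funM.
have int_psi : mu.-integrable [set: X] (EFin \o psi).
  exact: (integrableZl measurableT c int_p).
have int_eq : (\int[mu]_x (f x)%:E = \int[mu]_x (psi x)%:E)%E.
  rewrite /psi; under [RHS]eq_integral do rewrite EFinM.
  rewrite ge0_integralZl_EFin//; last exact/measurable_EFinP.
    rewrite -(fineK Ip_fin) -/Ip -EFinM /c divfK ?gt_eqF// fineK//.
    exact: integrable_fin_num.
  by move=> x _; rewrite lee_fin.
have [e e_surj] := enumerate_group symA genA.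
pose r n := (residual T f psi e n).1; pose s n := (residual T f psi e n).2.
pose u := moved T f psi e.
have r0 n x : 0 <= r n x by exact: (residual_ge0 mpa e f0 psi0 n x).1.
have s0 n x : 0 <= s n x by exact: (residual_ge0 mpa e f0 psi0 n x).2.
have mr n : measurable_fun [set: X] (r n) by exact: (measurable_residual mpa e mf mpsi n).1.
have ms n : measurable_fun [set: X] (s n) by exact: (measurable_residual mpa e mf mpsi n).2.
pose h n x := r n x + s n x.
have mh n : measurable_fun [set: X] (h n) by exact: measurable_funD.
have h0 n x : 0 <= h n x by exact: addr_ge0.
have hcvg : (\int[mu]_x (h n x)%:E)%E @[n --> \oo] --> 0%E.
  have rcvg : (\int[mu]_x (r n x)%:E)%E @[n --> \oo] --> 0%E.
    exact: (integral_residual_cvg0 mpa f0 psi0 mf mpsi int_f int_eq e_surj ergodic int_psi).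
  rewrite -(adde0 0%E).
  rewrite (_ : (fun n => _) = (fun n => \int[mu]_x (r n x)%:E + \int[mu]_x (r n x)%:E)%E).
    exact: cvgeD.
  apply/funext => n.
  rewrite [X in (_ = _ + X)%E](integral_residual mpa e f0 psi0 mf mpsi int_f int_eq n).
  rewrite -ge0_integralD//.
  - by move=> x _; rewrite lee_fin.
  - exact/measurable_EFinP.
  - by move=> x _; rewrite lee_fin s0.
  - by apply/measurable_EFinP; exact: ms.
have [Q Q1 growthQ] := orbit_growth.
(* The number m_inv m is both the tolerated deviation and the density of the
   indices excluded for lack of doubling. *)
pose m_inv (m : nat) : R := m.+1%:R^-1.
have m_inv0 m : 0 < m_inv m by rewrite invr_gt0.
pose D m := expR (5 * ln Q%:R / m_inv m).
have light : {ae mu, forall x, forall m, exists n, ~ heavy T A (m_inv m) (D m) p (h n) x}.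
  by apply: ae_foralln => m; apply: heavy_null => //; exact: expR_ge0.
apply: filterS2 growthQ light => x [C VC] light eps eps0 del del0.
pose V n := S n p x.
have V0 : 0 < V 0 by exact: ergodic_sum_ball_gt0.
have Vm m n : (m <= n)%N -> V m <= V n.
  by move=> mn; apply: sum_fset_subset => //; exact: ball_subset.
have Vp n : 0 < V n by exact: lt_le_trans V0 (Vm _ _ _).
have [m] : exists m, m_inv m <= Num.min (eps / 2) (del / 2).
  have mn0 : 0 < Num.min (eps / 2) (del / 2) by rewrite lt_min !divr_gt0.
  exists (Num.truncn (Num.min (eps / 2) (del / 2))^-1).
  by rewrite /m_inv invf_ple ?posrE// ltW// truncnS_gt.
rewrite le_min => /andP[m_eps m_del].
have [J lightJ] := light m.
pose z i := \sum_(j < J)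
  (S (slow_radius i) (u j) x - S (slow_radius i) (u j \o T (e j)^-1%g) x) / V (slow_radius i).
have zcvg : cvgd z 0.
  apply: (@cvgd_sum0 _ (fun j i =>
    (S (slow_radius i) (u j) x - S (slow_radius i) (u j \o T (e j)^-1%g) x) / V (slow_radius i))).
  move=> j eta eta0; have [k ek] := mem_some_ball symA genA (e j)^-1%g.
  have K1 : 0 < `|K| + 1 by rewrite ltr_wpDl.
  have eta1 : 0 < eta / (`|K| + 1) by rewrite divr_gt0.
  have := shell_density_zero V0 Vm Q1 VC k eta1.
  apply: (@density_zero_eventually _ _ _ k) => i ki /=; rewrite subr0.
  rewrite -/(V _) -/(V _) -/(V _); apply: contraTT; rewrite -!leNgt => shell.
  have ur y : 0 <= u j y <= K * p y.
    rewrite (moved_ge0 mpa e f0 psi0) /=; have /andP[_] := fK y; apply: le_trans.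
    exact: (moved_le mpa e f0 psi0).
  have kr : (k <= slow_radius i)%N by apply: leq_trans (ltnW ki) (leq_addr _ _).
  have := coboundary_le_shell x ur ek kr; rewrite -/(V _) -/(V _) => bound.
  rewrite normrM normfV (gtr0_norm (Vp _)) ler_pdivrMr//.
  apply: le_trans bound _.
  have sh0 : 0 <= V (slow_radius i + k)%N - V (slow_radius i - k)%N.
    rewrite subr_ge0; apply: Vm; exact: leq_trans (leq_subr _ _) (leq_addr _ _).
  apply: (@le_trans _ _ ((`|K| + 1) * (V (slow_radius i + k)%N - V (slow_radius i - k)%N))).
    by rewrite ler_wpM2r// (le_trans (ler_norm K))// lerDl.
  by move: shell; rewrite mulrAC ler_pdivlMr// mulrC.
have zc i : S (slow_radius i) f x / V (slow_radius i) - c =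
    z i + (S (slow_radius i) (r J) x - S (slow_radius i) (s J) x) / V (slow_radius i).
  have fE : S (slow_radius i) f x =
      S (slow_radius i) (r J) x + \sum_(j < J) S (slow_radius i) (u j) x.
    rewrite /ergodic_sum exchange_big -big_split; apply: eq_bigr => g _.
    exact: (residual_sum T f psi e J (T g x)).1.
  have psiE : c * V (slow_radius i) = S (slow_radius i) (s J) x +
      \sum_(j < J) S (slow_radius i) (u j \o T (e j)^-1%g) x.
    rewrite /V /ergodic_sum mulr_sumr exchange_big -big_split; apply: eq_bigr => g _.
    exact: (residual_sum T f psi e J (T g x)).2.
  have -> : z i = (\sum_(j < J) S (slow_radius i) (u j) x -
      \sum_(j < J) S (slow_radius i) (u j \o T (e j)^-1%g) x) / V (slow_radius i).
    by rewrite -sumrB mulr_suml.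
  have -> : c = c * V (slow_radius i) / V (slow_radius i) by rewrite mulfK ?gt_eqF.
  by rewrite psiE fE -mulrDl -mulrBl; congr (_ / _); ring.
apply: (@le_density_le _ _ (del / 2 + m_inv m)); first lra.
have del2 : 0 < del / 2 by rewrite divr_gt0.
apply: sub_density_le (density_le_setU (zcvg _ (m_inv0 m) _ del2)
  (doubling_density_le V0 Vm Q1 VC (m_inv0 m))) => i /= far.
apply: contrapT => /not_orP[/negP]; rewrite -leNgt subr0 => zi /negP; rewrite -leNgt => dbl.
apply: lightJ; exists (slow_radius i) => //; split=> //.
rewrite leNgt; apply/negP => hlt; move: far; apply/negP; rewrite -leNgt zc.
have hE : S (slow_radius i) (h J) x =
    S (slow_radius i) (r J) x + S (slow_radius i) (s J) x.
  by rewrite /ergodic_sum -big_split.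
have rs : `|(S (slow_radius i) (r J) x - S (slow_radius i) (s J) x) / V (slow_radius i)|
    <= m_inv m.
  rewrite normrM normfV (gtr0_norm (Vp _)) ler_pdivrMr//.
  apply: le_trans (ltW hlt); rewrite hE.
  have := ergodic_sum_ge0 T (B (slow_radius i)) x (r0 J).
  have := ergodic_sum_ge0 T (B (slow_radius i)) x (s0 J).
  by rewrite ler_norml; lra.
by apply: le_trans (ler_normD _ _) _; lra.
Qed.

(** Adding p makes f nonnegative and at most 2 p, and shifts both the ratio and
its limit by 1. *)
Lemma ratio_cvgd (f : X -> R) : measurable_fun [set: X] f ->
  (forall x, `|f x| <= p x) -> (0 < \int[mu]_x (p x)%:E)%E ->
  {ae mu, forall x, cvgd (fun i => S (slow_radius i) f x / S (slow_radius i) p x)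
    ((\int[mu]_x f x) / (\int[mu]_x p x))}.
Proof.
move=> mf fp Ip_gt0.
have int_f : mu.-integrable [set: X] (EFin \o f).
  apply: le_integrable int_p => //; first exact/measurable_EFinP.
  by move=> x _ /=; rewrite lee_fin (ger0_norm (p_ge0 x)).
have fp2 x : 0 <= f x + p x <= 2 * p x.
  by have := fp x; rewrite ler_norml => /andP[]; lra.
have Ip0 : \int[mu]_x p x != 0 by rewrite gt_eqF// fine_gt0// Ip_gt0 ltey_eq Ip_fin.
have := ratio_cvgd_dominated (measurable_funD mf mp) fp2 Ip_gt0.
rewrite -[fine (\int[mu]_x (f x + p x)%:E)]/(\int[mu]_x (f x + p x)).
rewrite -[fine (\int[mu]_x (p x)%:E)]/(\int[mu]_x p x) RintegralD//.
apply: filterS => x cvgfp.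
have -> : (\int[mu]_x f x) / (\int[mu]_x p x) =
    (\int[mu]_x f x + \int[mu]_x p x) / (\int[mu]_x p x) + - 1 by field.
apply: eq_cvgd (cvgdD cvgfp (cvgd_cst (-1))) => i.
have Sp : S (slow_radius i) p x != 0.
  by rewrite gt_eqF// ergodic_sum_ball_gt0.
have -> : S (slow_radius i) (f \+ p) x = S (slow_radius i) f x + S (slow_radius i) p x.
  by rewrite /ergodic_sum -big_split.
by rewrite mulrDl divff// addrK.
Qed.

End RatioTheorem.

Theorem theorem1p4 (R : realType) (G : groupType) (A : {fset G})
    (A_symmetric : symmetric_fset A) (A_generates : generates A)
    (A_growth : polynomial_growth R A) :
  exists n : nat -> nat,
    (forall i j : nat, (i < j)%N -> (n i < n j)%N) /\
    forall (d : measure_display) (X : measurableType d)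
      (mu : {measure set X -> \bar R}) (T : G -> X -> X),
      sigma_finite [set: X] mu ->
      measure_preserving_action mu T ->
      ergodic_action mu T ->
      forall phi psi : X -> R,
        mu.-integrable [set: X] (EFin \o phi) ->
        mu.-integrable [set: X] (EFin \o psi) ->
        \int[mu]_x psi x != 0 ->
        {ae mu, forall x,
          upper_density (R := R)
            [set i | ergodic_sum T (word_ball A (n i)) psi x = 0] = 0%E /\
          cvg_in_density
            (fun i => ergodic_ratio T (word_ball A (n i)) phi psi x)
            (\int[mu]_x phi x / \int[mu]_x psi x)}.
Proof.
exists slow_radius; split; first exact: slow_radius_lt.
move=> d X mu T sf mpa erg phi psi int_phi int_psi Ipsi0.
have [p0 [mp0 p0_gt0 int_p0]] := exists_pos_integrable sf.
have mphi : measurable_fun [set: X] phi by case/integrableP: int_phi => /measurable_EFinP.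
have mpsi : measurable_fun [set: X] psi by case/integrableP: int_psi => /measurable_EFinP.
pose p x := p0 x + (`|phi x| + `|psi x|).
have p_gt0 x : 0 < p x by rewrite ltr_pwDl// addr_ge0.
have mnorm (f : X -> R) : measurable_fun [set: X] f ->
  measurable_fun [set: X] (fun x => `|f x|) by move=> mf; exact: measurableT_comp.
have mp : measurable_fun [set: X] p.
  by apply: measurable_funD => //; apply: measurable_funD; exact: mnorm.
have int_p : mu.-integrable [set: X] (EFin \o p).
  have -> : EFin \o p = (EFin \o p0) \+ ((abse \o (EFin \o phi)) \+ (abse \o (EFin \o psi))).
    by apply/funext => x.
  by apply: integrableD => //; apply: integrableD => //; exact: integrable_abse.
have Ip_gt0 : (0 < \int[mu]_x (p x)%:E)%E.
  apply: (@lt_le_trans _ _ `|\int[mu]_x (psi x)%:E|)%E.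
    rewrite lt0e abse_eq0 abse_ge0 andbT; apply: contraNneq Ipsi0 => I0.
    by rewrite /Rintegral I0.
  apply: le_trans (le_abse_integral _ _ _) _ => //; first exact/measurable_EFinP.
  apply: ge0_le_integral => //.
  - by apply/measurable_EFinP; exact: mnorm.
  - exact/measurable_EFinP.
  - by move=> x _; rewrite lee_fin /p; have := p0_gt0 x; have := normr_ge0 (phi x); lra.
have Ip0 : \int[mu]_x p x != 0.
  by rewrite gt_eqF// fine_gt0// Ip_gt0 ltey_eq integrable_fin_num.
have phi_p x : `|phi x| <= p x.
  by rewrite /p; have := p0_gt0 x; have := normr_ge0 (psi x); lra.
have psi_p x : `|psi x| <= p x.
  by rewrite /p; have := p0_gt0 x; have := normr_ge0 (phi x); lra.
have cphi := ratio_cvgd mpa A_symmetric mp p_gt0 int_p A_generates A_growth erg mphi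
  phi_p Ip_gt0.
have cpsi := ratio_cvgd mpa A_symmetric mp p_gt0 int_p A_generates A_growth erg mpsi
  psi_p Ip_gt0.
have lim0 : (\int[mu]_x psi x) / (\int[mu]_x p x) != 0 by rewrite mulf_neq0 ?invr_eq0.
apply: filterS2 cphi cpsi => x cphi cpsi; split.
  apply: upper_density_eq0; apply: sub_density_zero (cvgd_neq0 cpsi lim0) => i /= ->.
  by rewrite mul0r.
move=> eps eps0; apply: upper_density_eq0.
have := cvgd_div cphi cpsi lim0 eps0; apply: sub_density_zero => i /=.
rewrite distrC /ergodic_ratio.
have Sp : ergodic_sum T (word_ball A (slow_radius i)) p x != 0.
  by rewrite gt_eqF//; apply: ergodic_sum_ball_gt0.
have cancel (a b c : R) : c != 0 -> a / c / (b / c) = a / b.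
  by move=> c0; rewrite invf_div mulrA divfK.
by rewrite !cancel.
Qed.
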